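(* Let $n\ge1$, $\delta>0$ and $\beta<n+2$, and let $\mathbf u\in(C^3(\mathbb{R}^n))^n$ and $x\in\mathbb{R}^n$. Let $$\mathcal L_s\mathbf u(x)=(\lambda^*-\mu)\frac{(c^{\delta,\beta})^2}{4}\int_{B_\delta(0)}\int_{B_\delta(0)}\frac{w}{\|w\|^\beta}\otimes\frac{q}{\|q\|^\beta}\,\mathbf u(x+w+q)\,dq\,dw .$$ Then for fixed $\beta<n+2$, $$\lim_{\delta\to0^+}\mathcal L_s\mathbf u(x)=(\lambda^*-\mu)\nabla(\nabla\cdot\mathbf u)(x),$$ and for fixed $\delta>0$, $$\lim_{\beta\to (n+2)^-}\mathcal L_s\mathbf u(x)=(\lambda^*-\mu)\nabla(\nabla\cdot\mathbf u)(x).$$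
   Context: $B_\delta(0)$ is the ball of radius $\delta$ centered at the origin in $\mathbb{R}^n$; $\mu,\lambda^*$ are real constants (Lamé parameters); $(a\otimes b)v=a\,(b\cdot v)$; and $$c^{\delta,\beta}=\frac{2(n+2-\beta)\,\Gamma\left(\frac n2+1\right)}{\pi^{n/2}\,\delta^{n+2-\beta}} .$$ When $n+1\le\beta<n+2$ the inner ($q$) and outer ($w$) integrals are understood as iterated principal values, i.e. each as $\lim_{\epsilon\to0^+}$ of the integral over $\{\epsilon<\|\cdot\|<\delta\}$. ($\mathcal L_s$ is the second, state-based, part of the linear peridynamic operator.) *)

(* Defs.v *)
From HB Require Import structures.
From mathcomp Require Import all_boot all_order all_algebra.
From mathcomp Require Import all_classical all_reals all_analysis.
Set Implicit Arguments.
Unset Strict Implicit.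
Unset Printing Implicit Defensive.
Import Order.TTheory GRing.Theory Num.Theory.
Import numFieldNormedType.Exports.
Local Open Scope classical_set_scope.
Local Open Scope ring_scope.

(* The library norm of ['rV[R]_n] is the sup norm: it induces the usual
   topology and derivatives, but the metric notions below need the Euclidean
   norm [enorm]. *)

Fact rV_display : measure_display.
Proof. exact: default_measure_display. Qed.

(* The sigma-algebra of R^n generated by the coordinates, i.e. the Borel one. *)
Section rV_measurable.
Context {R : realType} (n : nat).

Definition rV_coord (i : 'I_n) (v : 'rV[R]_n) : measurableTypeR R := v ord0 i.

Let rV_set0 : g_sigma_preimage rV_coord set0.
Proof. exact: sigma_algebra0. Qed.

Let rV_setC A : g_sigma_preimage rV_coord A ->
  g_sigma_preimage rV_coord (~` A).
Proof. exact: sigma_algebraC. Qed.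

Let rV_bigcup (F : (set 'rV[R]_n)^nat) :
  (forall i, g_sigma_preimage rV_coord (F i)) ->
  g_sigma_preimage rV_coord (\bigcup_i F i).
Proof. exact: sigma_algebra_bigcup. Qed.

HB.instance Definition _ := @isMeasurable.Build rV_display
  'rV[R]_n (g_sigma_preimage rV_coord) rV_set0 rV_setC rV_bigcup.

End rV_measurable.

Lemma measurable_rV_coord (R : realType) n (i : 'I_n) :
  measurable_fun [set: 'rV[R]_n] (@rV_coord R n i).
Proof.
move=> _ Y mY; rewrite setTI; apply: sub_sigma_algebra => /=.
rewrite -bigcup_seq/=; exists i => /=; first by rewrite mem_index_enum.
by exists Y => //; rewrite setTI.
Qed.

Lemma measurable_fun_rVP (R : realType) n d (T : measurableType d)
    (f : T -> 'rV[R]_n) :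
  (forall i, measurable_fun [set: T] (@rV_coord R n i \o f)) ->
  measurable_fun [set: T] f.
Proof.
move=> mf _ A mA; rewrite setTI.
have : g_sigma_preimage (fun i => @rV_coord R n i \o f) `<=` measurable.
  apply: smallest_sub; first exact: sigma_algebra_measurable.
  rewrite -bigcup_seq; apply: bigcup_sub => i _.
  by move=> B [C mC <-]; exact: mf.
apply; rewrite g_sigma_preimage_comp.
by exists A => //; rewrite setTI.
Qed.

Section lebesgue_measure_rV.
Context {R : realType}.

Definition rV_cons n (p : measurableTypeR R * 'rV[R]_n) : 'rV[R]_n.+1 :=
  \row_i oapp (p.2 ord0) p.1 (unlift ord0 i).

Definition rV_uncons n (v : 'rV[R]_n.+1) : measurableTypeR R * 'rV[R]_n :=
  (v ord0 ord0, \row_i v ord0 (lift ord0 i)).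

Lemma rV_consK n : cancel (@rV_cons n) (@rV_uncons n).
Proof.
move=> [a v]; rewrite /rV_uncons; congr (_, _); first by rewrite mxE unlift_none.
by apply/rowP => i; rewrite !mxE liftK.
Qed.

Lemma measurable_rV_cons n : measurable_fun setT (@rV_cons n).
Proof.
apply: measurable_fun_rVP => i; case: (unliftP ord0 i) => [j ->|->].
  rewrite (_ : _ \o _ = @rV_coord R n j \o snd); last first.
    by apply/funext => p; rewrite /= /rV_coord mxE liftK.
  by apply: measurableT_comp => //; exact: measurable_rV_coord.
rewrite (_ : _ \o _ = fst) //.
by apply/funext => p; rewrite /= /rV_coord mxE unlift_none.
Qed.

Lemma measurable_rV_uncons n : measurable_fun setT (@rV_uncons n).
Proof.
apply/measurable_fun_pairP; split; first exact: (measurable_rV_coord ord0).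
apply: measurable_fun_rVP => i.
rewrite (_ : _ \o _ = @rV_coord R n.+1 (lift ord0 i)).
  exact: measurable_rV_coord.
by apply/funext => v; rewrite /= /rV_coord mxE.
Qed.

Section step.
Context n (m : {sigma_finite_measure set 'rV[R]_n -> \bar R}).

Definition lebesgue_rV_step : set 'rV[R]_n.+1 -> \bar R :=
  pushforward (lebesgue_measure \x m)%E (@rV_cons n).

Let step0 : lebesgue_rV_step set0 = 0%E.
Proof. by rewrite /lebesgue_rV_step /pushforward preimage_set0 measure0. Qed.

Let preimageT A : measurable A -> measurable (@rV_cons n @^-1` A).
Proof.
by move=> mA; rewrite -[X in measurable X]setTI; exact: measurable_rV_cons.
Qed.

Let step_ge0 A : (0 <= lebesgue_rV_step A)%E.
Proof. exact: (@measure_ge0 _ _ _ (lebesgue_measure \x m)%E). Qed.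

Let step_sigma_additive : semi_sigma_additive lebesgue_rV_step.
Proof.
move=> F mF tF mUF; rewrite /lebesgue_rV_step /pushforward preimage_bigcup.
apply: measure_semi_sigma_additive.
- by move=> k; exact: preimageT.
- apply/trivIsetP => /= i j _ _ ij; rewrite -preimage_setI.
  by move/trivIsetP : tF => /(_ _ _ _ _ ij) ->//; rewrite preimage_set0.
- by rewrite -preimage_bigcup; exact: preimageT.
Qed.

HB.instance Definition _ := isMeasure.Build _ _ _ lebesgue_rV_step
  step0 step_ge0 step_sigma_additive.

Let step_sigma_finite : sigma_finite setT lebesgue_rV_step.
Proof.
have /sigma_finiteP[F [TF ndF Foo]] := sigma_finiteT (@lebesgue_measure R).
have /sigma_finiteP[G [TG ndG Goo]] := sigma_finiteT m.
exists (fun k => @rV_uncons n @^-1` (F k `*` G k)).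
  apply/esym; rewrite -subTset => v _.
  have [i _ Fi] : (\bigcup_i F i) (rV_uncons v).1 by rewrite -TF.
  have [j _ Gj] : (\bigcup_i G i) (rV_uncons v).2 by rewrite -TG.
  exists (maxn i j) => //; split.
    by move: Fi; apply/subsetPset/ndF/leq_maxl.
  by move: Gj; apply/subsetPset/ndG/leq_maxr.
move=> k; have [mF Fk] := Foo k; have [mG Gk] := Goo k; split.
  by rewrite -[X in measurable X]setTI; apply: measurable_rV_uncons => //;
    exact: measurableX.
rewrite /lebesgue_rV_step /pushforward -comp_preimage.
rewrite (_ : _ \o _ = id); last by apply/funext => p; exact: rV_consK.
by rewrite preimage_id product_measure1E// lte_mul_pinfty// ge0_fin_numE.
Qed.

HB.instance Definition _ := Measure_isSigmaFinite.Build _ _ _ lebesgue_rV_step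
  step_sigma_finite.

End step.

(* Lebesgue measure on R^n, as the n-fold product of Lebesgue measure on R. *)
Fixpoint lebesgue_rV n : {sigma_finite_measure set 'rV[R]_n -> \bar R} :=
  if n is m.+1 then lebesgue_rV_step (lebesgue_rV m) else \d_(0 : 'rV[R]_0).

End lebesgue_measure_rV.

Section vector_calculus.
Context {R : realType} {n : nat}.
Implicit Types (f : 'rV[R]_n -> R) (u : 'rV[R]_n -> 'rV[R]_n).

Definition edot (a b : 'rV[R]_n) : R := \sum_i a ord0 i * b ord0 i.

Definition enorm (a : 'rV[R]_n) : R := Num.sqrt (edot a a).

(* [tens a b v] is the tensor product of [a] and [b] applied to [v]. *)
Definition tens (a b v : 'rV[R]_n) : 'rV[R]_n := edot b v *: a.

Definition partial (i : 'I_n) f : 'rV[R]_n -> R :=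
  fun x => 'D_(delta_mx ord0 i) f x.

(* Class C^k: all iterated partial derivatives of order at most [k] exist and
   are continuous on the whole space. *)
Fixpoint Ck (k : nat) f : Prop :=
  continuous f /\
  if k is k'.+1 then
    forall i, (forall x, derivable f x (delta_mx ord0 i)) /\ Ck k' (partial i f)
  else True.

Definition Ck_field (k : nat) u : Prop :=
  forall i, Ck k (fun y => u y ord0 i).

Definition grad f : 'rV[R]_n -> 'rV[R]_n := fun x => \row_i partial i f x.

Definition divergence u : 'rV[R]_n -> R :=
  fun x => \sum_i partial i (fun y => u y ord0 i) x.

Definition vintegral (D : set 'rV[R]_n) u : 'rV[R]_n :=
  \row_i \int[lebesgue_rV n]_(z in D) u z ord0 i.

Definition annulus (e d : R) : set 'rV[R]_n := [set z | e < enorm z < d].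

Definition eball (d : R) : set 'rV[R]_n := [set z | enorm z < d].

(* The integral over the ball of radius [delta] of an integrand carrying the
   kernel [z / |z|^beta], which is absolutely integrable near 0 iff
   [beta < n + 1]; otherwise the integral is a principal value. *)
Definition ball_integral (delta beta : R) u : 'rV[R]_n :=
  if beta < n%:R + 1 then vintegral (eball delta) u
  else lim (vintegral (annulus e delta) u @[e --> 0^'+]).

End vector_calculus.

Definition Gamma {R : realType} (a : R) : R :=
  \int[lebesgue_measure]_(t in `]0, +oo[) (t `^ (a - 1) * expR (- t)).

Definition peri_c {R : realType} (n : nat) (delta beta : R) : R :=
  2 * (n%:R + 2 - beta) * Gamma (n%:R / 2 + 1)
  / (pi `^ (n%:R / 2) * delta `^ (n%:R + 2 - beta)).

Definition kern {R : realType} {n : nat} (beta : R) (z : 'rV[R]_n) : 'rV[R]_n :=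
  (enorm z `^ beta)^-1 *: z.

(* The state-based part of the linear peridynamic operator; [lambda] stands for
   the Lame parameter lambda^*. The variable [w] is the outer one. *)
Definition Ls {R : realType} {n : nat} (mu lambda delta beta : R)
    (u : 'rV[R]_n -> 'rV[R]_n) (x : 'rV[R]_n) : 'rV[R]_n :=
  ((lambda - mu) * (peri_c n delta beta ^+ 2 / 4)) *:
  ball_integral delta beta (fun w =>
    ball_integral delta beta (fun q =>
      tens (kern beta w) (kern beta q) (u (x + w + q)))).

(* Main.v *)
Require Import Defs.
From mathcomp Require Import all_boot all_order all_algebra.
From mathcomp Require Import all_classical all_reals all_analysis.
From mathcomp Require Import measurable_realfun ring lra.
Import Order.TTheory GRing.Theory Num.Theory.
Import numFieldNormedType.Exports.
Local Open Scope classical_set_scope.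
Local Open Scope ring_scope.
Set Implicit Arguments.
Unset Strict Implicit.

(** Write K(z) = z / |z|^beta for the kernel and B for the ball of radius d.

    B and the annuli are symmetric, so replacing an integrand by its even part
    under q -> -q changes neither the absolutely convergent integral nor the
    integrals over annuli.  As K is odd, the even part of K_j(q) f(y + q) is
    K_j(q) (f(y + q) - f(y - q)) / 2, which is O(|q|^(2 - beta)) for f of class C^1,
    hence integrable on B for every beta < n + 2.  The principal value therefore
    exists, and both readings of the ball integral give the same ordinary
    integral ([ball_integral_even_part]).

    Applied to the inner and then to the outer integral, this turns the i-th
    component of the double integral into a quarter of

      int_B int_B K_i(w) sum_j K_j(q) Delta_j(w, q) dq dw,

    Delta_j(w, q) being the second difference of u_j at x in the directions w
    and q ([second_diff]).  Two applications of the mean value theorem show that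
    Delta_j(w, q) equals 4 times the second derivative of u_j at x in the
    directions w and q, up to C |w| |q| (|w| + |q|), where C comes from a bound of
    the third derivatives near x ([C3_bounds]).

    Let m be the common value of the integrals of K_j(q) q_j over B; those of
    K_j(q) q_l vanish for j <> l because q_j -> - q_j preserves Lebesgue
    measure.  The second derivatives then contribute exactly m^2 times the i-th
    component of grad (div u), and the remainder contributes at most a constant
    times m2 m3, where m2 and m3 are the integrals of |q|^(2 - beta) and
    |q|^(3 - beta) over B ([inner_increment], [outer_estimate]).

    The constant c^(delta, beta) is the one for which c m = 2
    ([peri_c_coord_moment2]).  The error after multiplication by c^2 / 4 is thus
    of order m2 m3 / m^2, that is, of order d (n + 2 - beta) / (n + 3 - beta),
    with a constant that is uniform for bounded d ([Ls_estimate]).  It tends to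
    0 in both limits.

    The moments are computed from two facts.  A nonnegative density rho whose
    mass on the ball of radius r is M r^a is integrated against functions of
    |z| by exchanging integrals ([layer_cake]); against exp (-|z|^2) this gives
    M Gamma(a / 2 + 1) ([gaussian_homogeneous]) and against |z|^p it gives
    M a / (a + p) d^(a + p) on the ball of radius d ([homogeneous_moment]).
    On the other hand the Gaussian integrals factor over the coordinates.
    Comparing the two for rho = 1 gives the volume of the unit ball, and for
    rho = z_i^2 it shows that the n coordinates have the same second moment. *)

(** * Iterated integrals and diagonal scalings on R^n *)

Lemma ge0_integral_rV_cons (R : realType) n (f : 'rV[R]_n.+1 -> \bar R) :
  measurable_fun setT f -> (forall z, (0 <= f z)%E) ->
  (\int[@lebesgue_rV R n.+1]_z f z =
   \int[@lebesgue_measure R]_a \int[@lebesgue_rV R n]_v f (rV_cons (a, v)))%E.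
Proof.
move=> mf f0.
rewrite (@ge0_integral_pushforward _ _ _ _ _ _ (@measurable_rV_cons R n)
  (lebesgue_measure \x @lebesgue_rV R n)%E setT) // ?preimage_setT.
rewrite fubini_tonelli1 // => [|z]; last exact: f0.
by apply: measurableT_comp => //; exact: measurable_rV_cons.
Qed.

Lemma integral_rV0 (R : realType) (f : 'rV[R]_0 -> \bar R) :
  (\int[@lebesgue_rV R 0]_z f z = f 0%R)%E.
Proof.
rewrite integral_dirac ?diracE ?in_setT ?mul1e //.
have -> : f = cst (f 0) by apply/funext => z; congr f; apply/rowP => -[].
exact: measurable_cst.
Qed.

Section real_scaling.
Variable R : realType.
Local Notation mu := (@lebesgue_measure R).

Let scaling (d : R) : measurableTypeR R -> measurableTypeR R := *%R d.

Let measurable_scaling d : measurable_fun setT (scaling d).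
Proof. by apply: measurable_funM. Qed.

Lemma ge0_integral_scale (d : R) (f : R -> \bar R) : d != 0 ->
  measurable_fun [set: R] f -> (forall x, (0 <= f x)%E) ->
  (\int[mu]_x f (d * x)%R = (`|d|^-1)%:E * \int[mu]_x f x)%E.
Proof.
move=> d0 mf f0.
have d_gt0 : 0 < `|d| by rewrite normr_gt0.
pose nd : {nonneg R} := NngNum (normr_ge0 d).
have E A : measurable A -> mu A = mscale nd (pushforward mu (scaling d)) A.
  apply: lebesgue_measure_unique => _ [[a b]] _ <-.
  change (mu `]a, b]%classic = (`|d|%:E * mu (scaling d @^-1` `]a, b]%classic))%E).
  have [dp|dn|/eqP] := ltgtP 0 d; last by rewrite eq_sym (negbTE d0).
    rewrite (_ : scaling d @^-1` _ = `]a / d, b / d]%classic); last first.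
      apply/seteqP; split => x /=; rewrite !in_itv/= ltr_pdivrMr// ler_pdivlMr// mulrC //.
    rewrite !lebesgue_measure_itv /= !lte_fin ltr_pM2r ?invr_gt0 //.
    case: ifP; rewrite ?mule0 // => _; rewrite -!EFinB -EFinM; congr _%:E.
    by rewrite gtr0_norm// -mulrBl mulrC divfK.
  rewrite (_ : scaling d @^-1` _ = `[b / d, a / d[%classic); last first.
    by apply/seteqP; split => x /=; rewrite !in_itv/= ltr_ndivlMr// ler_ndivrMr// mulrC andbC.
  rewrite !lebesgue_measure_itv /= !lte_fin ltr_nM2r ?invr_lt0 //.
  case: ifP; rewrite ?mule0 // => _; rewrite -!EFinB -EFinM; congr _%:E.
  by rewrite ltr0_norm// -mulrBl mulrC mulrN divfK// opprB.
have := @ge0_integral_pushforward _ _ (measurableTypeR R) (measurableTypeR R) R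
  (scaling d) (@measurable_scaling d) mu setT f
  measurableT mf (fun _ _ => f0 _).
rewrite preimage_setT => <-.
rewrite [in RHS](@eq_measure_integral _ _ _ _ (mscale nd (pushforward mu (scaling d)))).
  rewrite ge0_integral_mscale //.
  by rewrite muleA -EFinM /= mulVf ?gt_eqF // mul1e.
by move=> A mA _; exact: E.
Qed.
End real_scaling.

Definition rV_scale (R : realType) n (d : 'I_n -> R) (z : 'rV[R]_n) : 'rV[R]_n :=
  \row_i (d i * z ord0 i).

Lemma measurable_rV_scale (R : realType) n (d : 'I_n -> R) :
  measurable_fun setT (rV_scale d).
Proof.
apply: measurable_fun_rVP => i.
rewrite (_ : _ \o _ = fun z => d i * @rV_coord R n i z); last first.
  by apply/funext => z; rewrite /= /rV_coord mxE.
by apply: measurable_funM => //; exact: measurable_rV_coord.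
Qed.

Lemma ge0_integral_rV_scale (R : realType) n (d : 'I_n -> R)
    (f : 'rV[R]_n -> \bar R) : (forall i, d i != 0) ->
  measurable_fun setT f -> (forall z, (0 <= f z)%E) ->
  (\int[@lebesgue_rV R n]_z f (rV_scale d z) =
    ((\prod_i `|d i|)^-1)%:E * \int[@lebesgue_rV R n]_z f z)%E.
Proof.
elim: n d f => [|n IH] d f d0 mf f0.
  rewrite !integral_rV0 big_ord0 invr1 mul1e; congr f.
  by apply/rowP => -[].
rewrite ge0_integral_rV_cons//; last first.
  by apply: measurableT_comp => //; exact: measurable_rV_scale.
have E a v : rV_scale d (rV_cons (a, v)) =
    rV_cons (d ord0 * a, rV_scale (fun i => d (lift ord0 i)) v).
  apply/rowP => i; rewrite !mxE.
  by case: (unliftP ord0 i) => [j ->|->] /=; rewrite ?mxE.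
have mfc : measurable_fun setT (fun p => f (@rV_cons R n p)).
  by apply: measurableT_comp => //; exact: measurable_rV_cons.
pose F a := (\int[@lebesgue_rV R n]_v f (rV_cons (a, v)))%E.
have mF : measurable_fun setT F.
  exact: (measurable_fun_fubini_tonelli_F (fun p => f (@rV_cons R n p))).
have F0 a : (0 <= F a)%E by apply: integral_ge0.
transitivity (\int[@lebesgue_measure R]_a
    (((\prod_i `|d (lift ord0 i)|)^-1)%:E * F (d ord0 * a)%R))%E.
  apply: eq_integral => a _; under eq_integral do rewrite E.
  rewrite (IH _ (fun v => f (rV_cons (d ord0 * a, v)))) //.
  exact: (measurableT_comp mfc (pair1_measurable _)).
rewrite ge0_integralZl//; last 2 first.
- apply: measurableT_comp => //; exact: measurable_funM.
- by rewrite lee_fin invr_ge0 prodr_ge0.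
rewrite ge0_integral_scale // muleA -EFinM -invfM big_ord_recl mulrC.
by rewrite ge0_integral_rV_cons.
Qed.

(** This is what makes Gaussian integrals on R^n computable. *)
Lemma ge0_integral_rV_prod (R : realType) n (g : 'I_n -> R -> R) :
  (forall i, measurable_fun setT (g i)) -> (forall i x, 0 <= g i x) ->
  (\int[@lebesgue_rV R n]_z (\prod_i g i (z ord0 i))%:E =
    \prod_i \int[@lebesgue_measure R]_x (g i x)%:E)%E.
Proof.
elim: n g => [|n IH] g mg g0.
  by rewrite integral_rV0 !big_ord0.
have mp m (h : 'I_m -> R -> R) : (forall i, measurable_fun setT (h i)) ->
    measurable_fun setT (fun z : 'rV[R]_m => (\prod_i h i (z ord0 i))%:E).
  move=> mh; apply/measurable_EFinP; apply: measurable_prod => i _.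
  apply: (@measurableT_comp _ _ _ _ _ _ (h i)) => //; exact: measurable_rV_coord.
rewrite ge0_integral_rV_cons//; last 2 first.
- exact: mp.
- by move=> z; rewrite lee_fin prodr_ge0.
pose K := (\int[@lebesgue_rV R n]_v (\prod_(i < n) g (lift ord0 i) (v ord0 i))%:E)%E.
transitivity (\int[@lebesgue_measure R]_a ((g ord0 a)%:E * K))%E.
  apply: eq_integral => a _.
  rewrite -ge0_integralZl//.
  - apply: eq_integral => v _; rewrite big_ord_recl /= mxE unlift_none -EFinM.
    by congr (_ * _)%:E; apply: eq_bigr => i _; rewrite mxE liftK.
  - by apply: (mp _ (fun i => g (lift ord0 i))) => i; exact: mg.
  - by move=> z _; rewrite lee_fin prodr_ge0.
  - by rewrite lee_fin.
rewrite ge0_integralZr//; last 3 first.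
- by apply/measurable_EFinP; exact: mg.
- by move=> z _; rewrite lee_fin.
- by apply: integral_ge0 => z _; rewrite lee_fin prodr_ge0.
by rewrite /K (IH (fun i => g (lift ord0 i))) // big_ord_recl.
Qed.

(** * Integrals of powers and exponentials on the line *)

Section one_variable.
Variable R : realType.
Local Notation mu := (@lebesgue_measure R).

Lemma continuous_powR_gt0 (p x : R) : 0 < x -> {for x, continuous (fun s : R => s `^ p)}.
Proof.
move=> x0; apply: differentiable_continuous; apply/derivable1_diffP.
by apply: derivable_powR; rewrite in_itv/= x0.
Qed.

Lemma integral_powR_cc (p a b : R) : p != 0 -> 0 < a -> a <= b ->
  (\int[mu]_(s in `[a, b]) (s `^ (p - 1))%:E)%E = ((b `^ p - a `^ p) / p)%:E.
Proof.
move=> p0 a0; rewrite le_eqVlt => /predU1P[<-|ab].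
  by rewrite set_itv1 integral_set1 subrr mul0r.
have c0 (x : R) : x \in `]a, b[%R -> 0 < x.
  by rewrite in_itv/= => /andP[/(lt_trans a0)].
rewrite (@continuous_FTC2 _ _ (fun s => p^-1 * s `^ p) a b ab).
- by rewrite -EFinB -mulrBr mulrC.
- apply/(continuous_within_itvP _ ab); split.
  + by move=> x /c0 ?; exact: continuous_powR_gt0.
  + by apply: cvg_at_right_filter; exact: continuous_powR_gt0.
  + by apply: cvg_at_left_filter; exact: continuous_powR_gt0 (lt_trans a0 ab).
- split.
  + move=> x /c0 x0; apply: derivableM => //.
    by apply: derivable_powR; rewrite in_itv/= x0.
  + apply: cvg_at_right_filter; apply: cvgM; first exact: cvg_cst.
    exact: continuous_powR_gt0.
  + apply: cvg_at_left_filter; apply: cvgM; first exact: cvg_cst.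
    exact: continuous_powR_gt0 (lt_trans a0 ab).
- move=> x /c0 x0.
  have xI : x \in `]0, +oo[%R by rewrite in_itv/= x0.
  have dx : derivable (@powR R ^~ p) x 1 by exact: derivable_powR.
  rewrite derive1E deriveM// derive_cst scaler0 addr0 -derive1E powR_derive1//.
  by rewrite /GRing.scale/= mulrA mulVf// mul1r.
Qed.

(** The integrand is unbounded at 0 when q < 1, so the fundamental theorem of
    calculus is applied between b / (k + 1) and b; k then tends to infinity. *)
Lemma integral_powR_0o (q b : R) : 0 < q -> 0 < b ->
  (\int[mu]_(s in `]0%R, b]) (s `^ (q - 1))%:E)%E = (b `^ q / q)%:E.
Proof.
move=> q0 b0.
pose c (k : nat) : R := b / k.+1%:R.
have c_gt0 k : 0 < c k by rewrite divr_gt0.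
have c_le k : c k <= b by rewrite ler_pdivrMr// ler_peMr ?(ltW b0)// ler1n.
pose F k := `[c k, b]%classic.
have mp D : measurable_fun D (fun s : R => (s `^ (q - 1))%:E).
  by apply/measurable_EFinP/measurable_funTS; exact: measurable_powR.
have ndF : nondecreasing_seq F.
  move=> i j ij; apply/subsetPset => s; rewrite /F /= !in_itv/= => /andP[cs ->].
  rewrite andbT (le_trans _ cs)// ler_pM2l// lef_pV2 ?posrE// ler_nat.
  by rewrite ltnS.
have UF : \bigcup_k F k = `]0%R, b]%classic.
  apply/seteqP; split => s /=.
    by move=> [k _]; rewrite /F /= !in_itv/= => /andP[cs ->]; rewrite (lt_le_trans _ cs).
  (* any k + 1 >= b / s puts s in F k *)
  rewrite in_itv/= => /andP[s0 sb]; exists (Num.trunc (b / s)) => //.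
  rewrite /F /= in_itv/= sb andbT ler_pdivrMr// mulrC -ler_pdivrMr//.
  by rewrite ltW// truncnS_gt.
have : (\int[mu]_(s in F i) (s `^ (q - 1))%:E)%E @[i --> \oo] -->
    (\int[mu]_(s in \bigcup_i F i) (s `^ (q - 1))%:E)%E.
  apply: ge0_nondecreasing_set_cvg_integral => //.
  - by move=> i; exact: measurable_itv.
  - by move=> i; exact: mp.
  - by move=> i x _; rewrite lee_fin powR_ge0.
rewrite UF => /cvg_lim <- //.
apply/cvg_lim => //.
rewrite (_ : (fun i => _) = (fun i => ((b `^ q - c i `^ q) / q)%:E)); last first.
  by apply/funext => i; rewrite integral_powR_cc ?gt_eqF.
apply: cvg_EFin; first exact: nearW.
rewrite -[X in X / q]subr0.
apply: cvgM; last exact: cvg_cst.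
apply: cvgB; first exact: cvg_cst.
apply: ((cvg_at_rightP _ _ _).1 (powR_cvg0 q0)); split => //.
rewrite -(mulr0 b); apply: cvgM; first exact: cvg_cst.
exact: cvg_harmonic.
Qed.

Lemma integral_expRN_oy (a : R) :
  (\int[mu]_(s in `]a, +oo[) (expR (- s))%:E)%E = (expR (- a))%:E.
Proof.
rewrite integral_itv_obnd_cbnd; last first.
  by apply/measurable_EFinP/measurable_funTS; apply: measurableT_comp.
have dE (x : R) : is_derive x 1 (fun s : R => - expR (- s)) (expR (- x)).
  have := is_deriveN (is_derive1_comp (is_derive_expR (- x)) (is_deriveNid x 1)).
  by rewrite mulrN1 opprK.
have cE (x : R) : {for x, continuous (fun s : R => - expR (- s))}.
  apply: differentiable_continuous; apply/derivable1_diffP.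
  by have [] := dE x.
rewrite (@ge0_continuous_FTC2y _ _ (fun s => - expR (- s)) a 0).
- by rewrite sub0e -EFinN opprK.
- by move=> x _; exact: expR_ge0.
- apply: continuous_subspaceT => x.
  by apply: continuous_comp; [exact: opp_continuous|exact: continuous_expR].
- by rewrite -oppr0; apply: cvgN; exact: cvgr_expR.
- by move=> x _; have [] := dE x.
- by apply: cvg_at_right_filter; exact: cE.
- by move=> x _; rewrite derive1E; apply: derive_val.
Qed.
End one_variable.

(** * The Euclidean norm and its balls *)

Section euclidean_norm.
Variables (R : realType) (n : nat).
Implicit Types z : 'rV[R]_n.

Lemma edotE z : edot z z = \sum_i z ord0 i ^+ 2.
Proof. by apply: eq_bigr => i _; rewrite expr2. Qed.

Lemma edot_ge0 z : 0 <= edot z z.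
Proof. by rewrite edotE sumr_ge0// => i _; exact: sqr_ge0. Qed.

Lemma enorm_ge0 z : 0 <= enorm z.
Proof. exact: sqrtr_ge0. Qed.

Lemma sqr_enorm z : enorm z ^+ 2 = \sum_i z ord0 i ^+ 2.
Proof. by rewrite sqr_sqrtr ?edot_ge0// edotE. Qed.

Lemma coord_le_enorm z i : `|z ord0 i| <= enorm z.
Proof.
rewrite -(@ler_pXn2r _ 2) ?nnegrE ?enorm_ge0// sqr_enorm real_normK ?num_real//.
by rewrite (bigD1 i)//= lerDl sumr_ge0// => j _; exact: sqr_ge0.
Qed.

Lemma enorm_eq0 z : enorm z = 0 -> z = 0.
Proof.
move=> z0; apply/rowP => i; rewrite mxE; apply/eqP; rewrite -normr_le0 -z0.
exact: coord_le_enorm.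
Qed.

Lemma enormZ (r : R) z : enorm (r *: z) = `|r| * enorm z.
Proof.
rewrite -[`|r|]sqrtr_sqr -sqrtrM ?sqr_ge0// /enorm; congr Num.sqrt.
rewrite !edotE mulr_sumr; apply: eq_bigr => i _; by rewrite mxE exprMn.
Qed.

Lemma enormN z : enorm (- z) = enorm z.
Proof. by rewrite -scaleN1r enormZ normrN1 mul1r. Qed.

Lemma enorm_rV_scale_sign (d : 'I_n -> R) z : (forall i, d i ^+ 2 = 1) ->
  enorm (rV_scale d z) = enorm z.
Proof.
move=> d1; rewrite /enorm !edotE; congr Num.sqrt.
by apply: eq_bigr => i _; rewrite mxE exprMn d1 mul1r.
Qed.

Lemma measurable_coord i : measurable_fun setT (fun z => z ord0 i : R).
Proof. exact: measurable_rV_coord. Qed.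

Lemma measurable_enorm : measurable_fun setT (@enorm R n).
Proof.
apply: (@measurableT_comp _ _ _ _ _ _ (@Num.sqrt R)).
  by apply: continuous_measurable_fun; exact: sqrt_continuous.
by apply: measurable_sum => i; apply: measurable_funM; exact: measurable_coord.
Qed.

End euclidean_norm.

Lemma measurable_lt_set d (T : measurableType d) (R : realType) (f g : T -> R) :
  measurable_fun setT f -> measurable_fun setT g ->
  measurable [set x | f x < g x].
Proof.
move=> mf mg.
have := measurable_fun_ltr mf mg measurableT (Y := [set true]).
by rewrite setTI; apply.
Qed.

Lemma measurable_le_set d (T : measurableType d) (R : realType) (f g : T -> R) :
  measurable_fun setT f -> measurable_fun setT g ->
  measurable [set x | f x <= g x].
Proof.
move=> mf mg.
have := measurable_fun_ler mf mg measurableT (Y := [set true]).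
by rewrite setTI; apply.
Qed.

Section balls.
Variables (R : realType) (n : nat).
Local Notation leb := (@lebesgue_rV R n).

Lemma measurable_eball (d : R) : measurable (@eball R n d).
Proof. by apply: measurable_lt_set => //; exact: measurable_enorm. Qed.

Lemma measurable_annulus (e d : R) : measurable (@annulus R n e d).
Proof.
rewrite (_ : annulus e d = [set z | e < enorm z] `&` eball d).
  apply: measurableI; last exact: measurable_eball.
  by apply: measurable_lt_set => //; exact: measurable_enorm.
by apply/seteqP; split => z /= => [/andP[]|[? ?]]; last exact/andP.
Qed.

(** Density of degree k in dimension n: the change of variables z -> r z gives
    the total degree n + k. *)
Lemma eball_integral_scale (rho : 'rV[R]_n -> R) (k : nat) (r : R) :
  measurable_fun setT rho -> (forall z, 0 <= rho z) ->
  (forall (s : R) z, 0 < s -> rho (s *: z) = s ^+ k * rho z) ->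
  0 < r ->
  (\int[leb]_(z in eball r) (rho z)%:E =
   (r `^ (n + k)%:R)%:E * \int[leb]_(z in eball 1) (rho z)%:E)%E.
Proof.
move=> mrho rho0 rhos r0.
pose f := ((fun z => (rho z)%:E) \_ (eball r)).
have f0 z : (0 <= f z)%E by rewrite /f patchE; case: ifP; rewrite ?lee_fin.
have mf : measurable_fun setT f.
  apply/(measurable_restrictT _ (measurable_eball r)).
  by apply: measurable_funTS; exact/measurable_EFinP.
have H := @ge0_integral_rV_scale R n (fun _ => r) f (fun _ => lt0r_neq0 r0) mf f0.
have H2 : (\int[leb]_z f (rV_scale (fun=> r) z) =
  (r ^+ k)%:E * \int[leb]_(z in eball 1) (rho z)%:E)%E.
  rewrite -ge0_integralZl//; last 4 first.
  - exact: measurable_eball.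
  - by apply: measurable_funTS; exact/measurable_EFinP.
  - by move=> z _; rewrite lee_fin.
  - by rewrite lee_fin exprn_ge0 // ltW.
  rewrite [RHS]integral_mkcond; apply: eq_integral => z _.
  have E : rV_scale (fun=> r) z = r *: z by apply/rowP => i; rewrite !mxE.
  rewrite /f !patchE E.
  have -> : (r *: z \in eball r) = (z \in eball 1).
    apply/idP/idP; rewrite !inE /eball /= enormZ gtr0_norm//.
      by rewrite gtr_pMr.
    by rewrite gtr_pMr.
  by case: ifP => // _; rewrite rhos.
rewrite [LHS]integral_mkcond -/f.
have := etrans (esym H2) H.
rewrite prodr_const card_ord gtr0_norm// => /(congr1 (fun x => (r ^+ n)%:E * x)%E).
rewrite !muleA -!EFinM mulfV ?mul1e ?lt0r_neq0 ?exprn_gt0// => <-.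
by rewrite -exprD powR_mulrn// ltW.
Qed.

End balls.

(** * Radial integrals of homogeneous densities *)

Section layer_cake.
Variables (R : realType) (n : nat) (rho : 'rV[R]_n -> R) (a : R).
Local Notation leb := (@lebesgue_rV R n).
Local Notation mu := (@lebesgue_measure R).
Hypothesis mrho : measurable_fun setT rho.
Hypothesis rho_ge0 : forall z, 0 <= rho z.

(** Tonelli's theorem for rho(z) g(s) restricted to A.  With A = {|z| < s}, one
    order of integration shows radial functions of z, the other one the
    masses that rho gives to balls. *)
Lemma layer_cake (A : set ('rV[R]_n * R)) (g : R -> R) :
  measurable A -> measurable_fun setT g -> (forall s, 0 <= g s) ->
  (\int[leb]_z ((rho z)%:E * \int[mu]_(s in [set s | A (z, s)]) (g s)%:E) =
   \int[mu]_s ((g s)%:E * \int[leb]_(z in [set z | A (z, s)]) (rho z)%:E))%E.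
Proof.
move=> mA mg g0.
pose K := (fun p : 'rV[R]_n * R => (rho p.1 * g p.2)%:E) \_ A.
have mrg : measurable_fun setT (fun p : 'rV[R]_n * R => rho p.1 * g p.2).
  by apply: measurable_funM; apply: measurableT_comp.
have mK : measurable_fun setT K.
  by apply/(measurable_restrictT _ mA); apply: measurable_funTS; exact/measurable_EFinP.
have K0 p : (0 <= K p)%E.
  by rewrite /K patchE; case: ifP => // _; rewrite lee_fin mulr_ge0.
have mAz z : measurable [set s | A (z, s)].
  have := pair1_measurable (T1 := 'rV[R]_n) (T2 := R) z measurableT mA.
  by rewrite setTI.
have mAs s : measurable [set z | A (z, s)].
  have := pair2_measurable (T1 := 'rV[R]_n) (T2 := R) s measurableT mA.
  by rewrite setTI.
have L := @fubini_tonelli _ _ _ _ R leb mu K mK K0.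
transitivity (\int[leb]_z \int[mu]_s K (z, s))%E.
  apply: eq_integral => z _.
  rewrite -ge0_integralZl//; last 4 first.
  - exact: mAz.
  - by apply: measurable_funTS; exact/measurable_EFinP.
  - by move=> s _; rewrite lee_fin.
  - by rewrite lee_fin.
  rewrite integral_mkcond; apply: eq_integral => s _.
  have sA : (s \in [set s | A (z, s)]) = ((z, s) \in A) by apply/idP/idP; rewrite !inE.
  by rewrite /K !patchE sA; case: ifP => // _; rewrite EFinM.
rewrite L; apply: eq_integral => s _.
rewrite -ge0_integralZl//; last 3 first.
- by apply: measurable_funTS; exact/measurable_EFinP.
- by move=> z _; rewrite lee_fin.
- by rewrite lee_fin.
rewrite [RHS]integral_mkcond; apply: eq_integral => z _.
have zA : (z \in [set z | A (z, s)]) = ((z, s) \in A) by apply/idP/idP; rewrite !inE.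
by rewrite /K !patchE zA; case: ifP => // _; rewrite -EFinM mulrC.
Qed.

(** exp (-|z|^2) is the integral of exp (-s) over s > |z|^2, and the ball of
    radius sqrt s has mass s^(a / 2) M. The integral on the right is
    Gamma (a / 2 + 1), kept as an extended real so that no finiteness has to be
    known beforehand. *)
Lemma gaussian_homogeneous (M : \bar R) : 0 < a ->
  (forall r : R, 0 < r ->
    (\int[leb]_(z in eball r) (rho z)%:E = (r `^ a)%:E * M)%E) ->
  (\int[leb]_z (rho z * expR (- enorm z ^+ 2))%:E =
   M * \int[mu]_(s in `]0%R, +oo[) (s `^ (a / 2) * expR (- s))%:E)%E.
Proof.
move=> a0 HM.
have M0 : (0 <= M)%E.
  have := HM 1 ltr01; rewrite powR1 mul1e => <-.
  by apply: integral_ge0 => z _; rewrite lee_fin.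
pose A := [set p : 'rV[R]_n * R | enorm p.1 ^+ 2 < p.2].
have mA : measurable A.
  apply: measurable_lt_set => //.
  by apply: measurable_funX; apply: measurableT_comp => //; exact: measurable_enorm.
have me : measurable_fun setT (fun s : R => expR (- s)) by exact: measurableT_comp.
have := layer_cake mA me (fun s => expR_ge0 _).
under eq_integral => z _.
  rewrite (_ : [set s | A (z, s)] = `]enorm z ^+ 2, +oo[%classic); last first.
    by apply/seteqP; split => s /=; rewrite in_itv/= andbT.
  rewrite integral_expRN_oy -EFinM.
  over.
move=> ->.
rewrite -ge0_integralZl//; last 2 first.
- apply: measurable_funTS; apply/measurable_EFinP; apply: measurable_funM.
    exact: measurable_powR.
  exact: me.
- by move=> s _; rewrite lee_fin mulr_ge0 ?powR_ge0 ?expR_ge0.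
rewrite [RHS]integral_mkcond; apply: eq_integral => s _; rewrite patchE.
rewrite mem_setE in_itv/= andbT; case: ltP => s0.
  rewrite (_ : [set z | A (z, s)] = eball (Num.sqrt s)); last first.
    apply/seteqP; split => z /=; rewrite /A/= /eball/= => h.
      by rewrite -[enorm z]ger0_norm ?enorm_ge0// -sqrtr_sqr ltr_sqrt.
    by rewrite -[s]sqr_sqrtr ?ltW// ltr_pXn2r ?nnegrE ?enorm_ge0 ?sqrtr_ge0.
  rewrite HM ?sqrtr_gt0// -powR12_sqrt ?ltW// -powRrM [_^-1 * a]mulrC.
  by rewrite muleA -EFinM muleC [expR _ * _]mulrC.
rewrite (_ : [set z | A (z, s)] = set0) ?integral_set0 ?mule0//.
apply/seteqP; split => z //=; rewrite /A/= => /(le_lt_trans (sqr_ge0 _)).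
by rewrite ltNge s0.
Qed.

(** For p <> 0, (d^p - |z|^p) / p is the integral of s^(p - 1) for |z| < s < d,
    a nonnegative quantity for either sign of p; integrating it against rho
    and solving for |z|^p avoids a separate treatment of the singular case
    p < 0.  The alternative [rho 0 = 0 \/ 0 < p] copes with the convention that
    0 to a nonzero power is 0. *)
Lemma homogeneous_moment (M p d : R) : 0 < a -> 0 < a + p -> 0 < d ->
  (rho 0 = 0 \/ 0 < p) ->
  (forall r : R, 0 < r ->
    (\int[leb]_(z in eball r) (rho z)%:E)%E = (r `^ a * M)%:E) ->
  leb.-integrable (eball d) (EFin \o (fun z => rho z * enorm z `^ p)) /\
  (\int[leb]_(z in eball d) (rho z * enorm z `^ p))%R =
    M * (a / (a + p)) * d `^ (a + p).
Proof.
move=> a0 ap0 d0 rp HM.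
have mB := @measurable_eball R n d.
have mrhop q : measurable_fun setT (fun z => rho z * enorm z `^ q).
  apply: measurable_funM => //; apply: (measurableT_comp (measurable_powR _)).
  exact: measurable_enorm.
have irho : leb.-integrable (eball d) (EFin \o rho).
  apply/integrableP; split.
    by apply: measurable_funTS; exact/measurable_EFinP.
  under eq_integral do rewrite /= ger0_norm//.
  by rewrite HM// ltry.
have Irho : (\int[leb]_(z in eball d) rho z)%R = d `^ a * M.
  by rewrite /Rintegral HM.
have [p0|p_neq0] := eqVneq p 0.
  move: rp; rewrite p0 ltxx => -[r0|//]; split.
    by under [X in EFin \o X]eq_fun do rewrite powRr0 mulr1.
  under eq_Rintegral do rewrite powRr0 mulr1.
  by rewrite Irho addr0 mulfV ?gt_eqF// mulr1 mulrC.
pose A := [set q : 'rV[R]_n * R | enorm q.1 < q.2] `&` [set q | q.2 <= d].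
have mA : measurable A.
  apply: measurableI; last exact: measurable_le_set.
  apply: measurable_lt_set => //.
  by apply: measurableT_comp => //; exact: measurable_enorm.
have Az z : [set s | A (z, s)] = `]enorm z, d]%classic.
  by apply/seteqP; split => s /=; rewrite in_itv/= => /andP.
have mp D : measurable_fun D (fun s : R => s `^ (p - 1)).
  by apply: measurable_funTS; exact: measurable_powR.
have H := layer_cake mA (mp setT) (fun s => powR_ge0 _ _).
pose h z := rho z * ((d `^ p - enorm z `^ p) / p).
have h_ge0 z : eball d z -> 0 <= h z.
  rewrite /eball /= => zd; have [z0|z_neq0] := eqVneq (enorm z) 0.
    case: rp => [r0|p_gt0]; first by rewrite /h (enorm_eq0 z0) r0 mul0r.
    by rewrite /h z0 powR0 ?gt_eqF// subr0 mulr_ge0// divr_ge0 ?powR_ge0// ltW.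
  have z_gt0 : 0 < enorm z by rewrite lt0r z_neq0 enorm_ge0.
  have := integral_powR_cc p_neq0 z_gt0 (ltW zd).
  move=> E; rewrite /h mulr_ge0// -lee_fin -E.
  by apply: integral_ge0 => s _; rewrite lee_fin powR_ge0.
have Hl : (\int[leb]_(z in eball d) (h z)%:E = (d `^ (a + p) / (a + p) * M)%:E)%E.
  transitivity (\int[leb]_z ((rho z)%:E *
      \int[mu]_(s in [set s | A (z, s)]) (s `^ (p - 1))%:E))%E.
    rewrite integral_mkcond; apply: eq_integral => z _; rewrite patchE Az.
    case: ifPn => [|/negP]; rewrite inE /eball/= => zd; last first.
      rewrite set_itv_ge ?integral_set0 ?mule0// bnd_simp.
      by apply/negP.
    have [z0|z_neq0] := eqVneq (enorm z) 0.
      case: rp => [r0|p_gt0]; first by rewrite /h (enorm_eq0 z0) r0 mul0r mul0e.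
      by rewrite /h z0 powR0 ?gt_eqF// subr0 integral_powR_0o.
    have z_gt0 : 0 < enorm z by rewrite lt0r z_neq0 enorm_ge0.
    rewrite integral_itv_obnd_cbnd; last exact/measurable_EFinP.
    by rewrite integral_powR_cc// ltW.
  rewrite H.
  transitivity (\int[mu]_(s in `]0%R, d]) (M%:E * (s `^ (a + p - 1))%:E))%E.
    rewrite [RHS]integral_mkcond; apply: eq_integral => s _; rewrite patchE.
    rewrite mem_setE in_itv/=; case: ifPn => [/andP[s0 sd]|sN].
      rewrite (_ : [set z | A (z, s)] = eball s); last first.
        by apply/seteqP; split => z /=; [case|move=> zs; split].
      rewrite HM// -!EFinM mulrA [in RHS]mulrC -powRD; last first.
        by rewrite (gt_eqF s0) implybT.
      by rewrite [p - 1 + a]addrC addrA.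
    rewrite (_ : [set z | A (z, s)] = set0) ?integral_set0 ?mule0//.
    apply/seteqP; split => z //= -[/= zs sd]; move: sN.
    by rewrite sd andbT (le_lt_trans (enorm_ge0 z) zs).
  rewrite ge0_integralZl//; last 3 first.
  - by apply/measurable_EFinP/measurable_funTS; exact: measurable_powR.
  - by move=> s _; rewrite lee_fin powR_ge0.
  - have := HM 1 ltr01; rewrite powR1 mul1r => <-.
    by apply: integral_ge0 => z _; rewrite lee_fin.
  by rewrite integral_powR_0o// -EFinM mulrC.
have ih : leb.-integrable (eball d) (EFin \o h).
  apply/integrableP; split.
    apply: measurable_funTS; apply/measurable_EFinP.
    apply: measurable_funM => //; apply: measurable_funM => //.
    apply: measurable_funB => //; apply: (measurableT_comp (measurable_powR _)).
    exact: measurable_enorm.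
  rewrite (eq_integral (EFin \o h)) ?Hl ?ltry// => z; rewrite inE => /h_ge0 hz.
  by rewrite /= ger0_norm.
have E z : rho z * enorm z `^ p = d `^ p * rho z - p * h z.
  by rewrite /h; field.
have ir : leb.-integrable (eball d) (fun z => (d `^ p * rho z)%:E).
  exact: (@integrableZl _ _ _ leb _ mB (d `^ p) (EFin \o rho)).
have ip : leb.-integrable (eball d) (fun z => (p * h z)%:E).
  exact: (@integrableZl _ _ _ leb _ mB p (EFin \o h)).
split.
  rewrite (_ : EFin \o _ = (fun z => (d `^ p * rho z)%:E) \- (fun z => (p * h z)%:E))%E.
    exact: integrableB.
  by apply/funext => z; rewrite /= E.
under eq_Rintegral do rewrite E.
rewrite RintegralB// !RintegralZl// Irho /Rintegral Hl /=.
rewrite powRD; last by rewrite gt_eqF.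
by field; rewrite gt_eqF.
Qed.
End layer_cake.

(** * Volume and moments of Euclidean balls *)

Section gaussian.
Variable R : realType.
Local Notation mu := (@lebesgue_measure R).

Lemma expRN_sqr_enorm n (z : 'rV[R]_n) :
  expR (- enorm z ^+ 2) = \prod_i gauss_fun (z ord0 i).
Proof.
rewrite sqr_enorm -sumrN; elim/big_ind2: _ => //; first exact: expR0.
by move=> x1 x2 y1 y2 <- <-; rewrite expRD.
Qed.

Lemma integral_rV_gauss n :
  (\int[@lebesgue_rV R n]_z (expR (- enorm z ^+ 2))%:E = (pi `^ (n%:R / 2))%:E)%E.
Proof.
under eq_integral do rewrite expRN_sqr_enorm.
rewrite (@ge0_integral_rV_prod R n (fun _ => gauss_fun)); last 2 first.
- by move=> _; exact: measurable_gauss_fun.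
- by move=> _ x; exact: gauss_fun_ge0.
rewrite (eq_bigr (fun _ => (Num.sqrt pi)%:E)); last by move=> i _; exact: integralT_gauss.
rewrite prodEFin prodr_const card_ord -powR12_sqrt ?pi_ge0//.
by rewrite -powR_mulrn ?powR_ge0// -powRrM mulrC.
Qed.

(** Only positivity and finiteness matter: this value cancels when the
    second moments of two coordinates are compared. *)
Lemma gauss_second_moment :
  exists2 K : R, 0 < K & (\int[mu]_x (x ^+ 2 * gauss_fun x)%:E = K%:E)%E.
Proof.
have mg : measurable_fun setT (fun x : R => x ^+ 2 * gauss_fun x).
  by apply: measurable_funM => //; exact: measurable_gauss_fun.
have ge0 (x : R) : 0 <= x ^+ 2 * gauss_fun x.
  by rewrite mulr_ge0 ?sqr_ge0 ?gauss_fun_ge0.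
set I := (\int[mu]_x _)%E.
have I_fin : (I < +oo)%E.
  (* t^2 exp (-t^2) <= 2 exp (-t^2 / 2), and t^2 / 2 = (c t)^2 *)
  pose c : R := Num.sqrt 2^-1.
  have c_gt0 : 0 < c by rewrite sqrtr_gt0.
  have c2 : c ^+ 2 = 2^-1 by rewrite sqr_sqrtr.
  apply: (@le_lt_trans _ _ (\int[mu]_x (2 * gauss_fun (c * x))%:E)%E).
    apply: ge0_le_integral => //.
    - by move=> x _; rewrite lee_fin.
    - exact/measurable_EFinP.
    - apply/measurable_EFinP; apply: measurable_funM => //.
      by apply: (measurableT_comp measurable_gauss_fun); exact: measurable_funM.
    - move=> x _; rewrite lee_fin /gauss_fun exprMn c2.
      have -> : - x ^+ 2 = - (2^-1 * x ^+ 2) + - (2^-1 * x ^+ 2) by field.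
      rewrite expRD mulrA ler_pM2r ?expR_gt0// expRN.
      rewrite ler_pdivrMr ?expR_gt0//.
      have := expR_ge1Dx (2^-1 * x ^+ 2); lra.
  under eq_integral do rewrite EFinM.
  rewrite ge0_integralZl//; last 2 first.
  - apply/measurable_EFinP.
    by apply: (measurableT_comp measurable_gauss_fun); exact: measurable_funM.
  - by move=> x _; rewrite lee_fin gauss_fun_ge0.
  rewrite (@ge0_integral_scale _ c (fun x => (gauss_fun x)%:E)) ?gt_eqF//; last 2 first.
  - by apply/measurable_EFinP; exact: measurable_gauss_fun.
  - by move=> x; rewrite lee_fin gauss_fun_ge0.
  by rewrite integralT_gauss -!EFinM ltry.
have I_gt0 : (0 < I)%E.
  (* on [1, 2] the integrand is at least exp (-4) *)
  have h : (0 < \int[mu]_(x in `[1%R, 2%R]) (expR (- 4))%:E)%E.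
    rewrite integral_cst//= lebesgue_measure_itv/= lte_fin ltr1n.
    by rewrite -EFinB -EFinM lte_fin mulr_gt0 ?expR_gt0// subr_gt0 ltr1n.
  apply: (lt_le_trans h).
  apply: (@le_trans _ _ (\int[mu]_(x in `[1%R, 2%R]) (x ^+ 2 * gauss_fun x)%:E)%E).
    apply: ge0_le_integral => //.
    - by apply/measurable_EFinP; exact: (measurable_funTS mg).
    - move=> x /=; rewrite in_itv/= => /andP[x1 x2]; rewrite lee_fin.
      rewrite -[leLHS]mul1r ler_pM ?expR_ge0//; first by rewrite exprn_ege1.
      by rewrite ler_expR; nra.
  apply: ge0_subset_integral => //; first exact/measurable_EFinP.
  by move=> x _; rewrite lee_fin.
exists (fine I); first by rewrite fine_gt0// I_gt0.
by rewrite fineK// ge0_fin_numE// ltW.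
Qed.

End gaussian.

Section moments.
Variables (R : realType) (n : nat).
Hypothesis n_gt0 : (0 < n)%N.
Local Notation leb := (@lebesgue_rV R n).
Local Notation mu := (@lebesgue_measure R).

Definition ball_vol : R := fine (\int[leb]_(z in eball 1) 1%:E)%E.

Let gamma_factor (a : R) := (\int[mu]_(s in `]0%R, +oo[) (s `^ a * expR (- s))%:E)%E.

Let gamma_factor_ge0 a : (0 <= gamma_factor a)%E.
Proof. by apply: integral_ge0 => s _; rewrite lee_fin mulr_ge0 ?powR_ge0 ?expR_ge0. Qed.

(** A product that is finite and positive forces both factors to be so; this
    yields at once the finiteness of ball masses and of Gamma integrals. *)
Let ge0_mule_fin (x y : \bar R) (k : R) : (0 <= x)%E -> (0 <= y)%E -> 0 < k ->
  (x * y = k%:E)%E -> exists a b : R, [/\ 0 < a, 0 < b, x = a%:E & y = b%:E].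
Proof.
move: x y => [x| |] [y| |].
- rewrite !lee_fin => x0 y0 k0 -[xy]; exists x, y; split => //.
    by rewrite lt0r x0 andbT; apply/eqP => E; move: xy k0; rewrite E mul0r => <-; rewrite ltxx.
  by rewrite lt0r y0 andbT; apply/eqP => E; move: xy k0; rewrite E mulr0 => <-; rewrite ltxx.
- rewrite lee_fin le_eqVlt => /predU1P[<- _ k0|x0 _ k0].
    by rewrite mul0e => -[E]; move: k0; rewrite -E ltxx.
  by rewrite mulry gtr0_sg// mul1e.
- by move=> _; rewrite leNgt ltNy0.
- move=> _; rewrite lee_fin le_eqVlt => /predU1P[<- k0|y0 k0].
    by rewrite mule0 => -[E]; move: k0; rewrite -E ltxx.
  by rewrite mulyr gtr0_sg// mul1e.
- by rewrite mulyy.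
- by move=> _; rewrite leNgt ltNy0.
- by rewrite leNgt ltNy0.
- by rewrite leNgt ltNy0.
- by rewrite leNgt ltNy0.
Qed.

Let measurable_cst1 : measurable_fun setT (cst 1 : 'rV[R]_n -> R).
Proof. exact: measurable_cst. Qed.

Let ball_vol_gamma :
  [/\ 0 < ball_vol, (\int[leb]_(z in eball 1) 1%:E = ball_vol%:E)%E &
   ball_vol * Gamma (n%:R / 2 + 1) = pi `^ (n%:R / 2)].
Proof.
have H r : 0 < r -> (\int[leb]_(z in eball r) 1%:E =
    (r `^ n%:R)%:E * \int[leb]_(z in eball 1) 1%:E)%E.
  move=> r0.
  rewrite (@eball_integral_scale R n (fun _ => 1) 0 r) ?addn0//.
  by move=> *; rewrite expr0 mul1r.
have := gaussian_homogeneous measurable_cst1 (fun _ => ler01) _ H.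
rewrite ltr0n n_gt0 => /(_ isT).
under eq_integral do rewrite mul1r.
rewrite integral_rV_gauss -/(gamma_factor _) => /esym E.
have [|||a [b [a0 b0 Ea Eb]]] := ge0_mule_fin _ _ _ E.
- by apply: integral_ge0 => z _; rewrite lee_fin.
- exact: gamma_factor_ge0.
- by rewrite powR_gt0 ?pi_gt0.
rewrite /ball_vol Ea; split => //.
move: E; rewrite Ea Eb -EFinM => -[<-]; congr (_ * _).
rewrite /Gamma /Rintegral addrK.
by have := Eb; rewrite /gamma_factor => ->.
Qed.

Lemma ball_vol_gt0 : 0 < ball_vol. Proof. by case: ball_vol_gamma. Qed.

Lemma ball_vol_Gamma : ball_vol * Gamma (n%:R / 2 + 1) = pi `^ (n%:R / 2).
Proof. by case: ball_vol_gamma. Qed.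

Let vol_eball (r : R) : 0 < r ->
  (\int[leb]_(z in eball r) 1%:E)%E = (r `^ n%:R * ball_vol)%:E.
Proof.
move=> r0.
rewrite (@eball_integral_scale R n (fun _ => 1) 0 r) ?addn0//.
  by case: ball_vol_gamma => _ -> _; rewrite EFinM.
by move=> *; rewrite expr0 mul1r.
Qed.

Let coord2 i := fun z : 'rV[R]_n => z ord0 i ^+ 2.
Let mcoord2 i : measurable_fun setT (coord2 i).
Proof. by apply: measurable_funX; exact: measurable_coord. Qed.
Let coord2_ge0 i z : 0 <= coord2 i z. Proof. exact: sqr_ge0. Qed.

Let M i := fine (\int[leb]_(z in eball 1) (coord2 i z)%:E)%E.

Let coord2_le i z : eball 1 z -> coord2 i z <= 1.
Proof.
move=> z1; rewrite /coord2 -real_normK ?num_real// exprn_ile1//.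
exact: le_trans (coord_le_enorm z i) (ltW z1).
Qed.

Let M_E i : (\int[leb]_(z in eball 1) (coord2 i z)%:E)%E = (M i)%:E.
Proof.
rewrite fineK// ge0_fin_numE; last by apply: integral_ge0 => z _; rewrite lee_fin.
apply: (@le_lt_trans _ _ (\int[leb]_(z in eball 1) 1%:E)%E).
  apply: ge0_le_integral => //.
  - exact: measurable_eball.
  - by move=> z _; rewrite lee_fin.
  - by apply: measurable_funTS; exact/measurable_EFinP.
  - by move=> z z1; rewrite lee_fin coord2_le.
by rewrite vol_eball// ltry.
Qed.

Let coord2_eball i (r : R) : 0 < r ->
  (\int[leb]_(z in eball r) (coord2 i z)%:E)%E = (r `^ (n%:R + 2) * M i)%:E.
Proof.
move=> r0.
rewrite (@eball_integral_scale R n (coord2 i) 2 r) ?natrD ?M_E ?EFinM//.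
by move=> s z _; rewrite /coord2 mxE exprMn.
Qed.


(** The integral of z_k^2 exp (-|z|^2) is a product of one-dimensional integrals
    whose value does not depend on k, and it is M k times a Gamma factor that
    does not depend on k either. *)
Let M_all_eq i j : M i = M j.
Proof.
have [K K0 KE] := @gauss_second_moment R.
pose C : R := K * Num.sqrt pi ^+ n.-1.
have C0 : 0 < C by rewrite mulr_gt0// exprn_gt0// sqrtr_gt0 pi_gt0.
have E k : ((M k)%:E * gamma_factor ((n%:R + 2) / 2) = C%:E)%E.
  have H r : 0 < r -> (\int[leb]_(z in eball r) (coord2 k z)%:E =
    (r `^ (n%:R + 2))%:E * (M k)%:E)%E by move=> r0; rewrite coord2_eball.
  have := gaussian_homogeneous (mcoord2 k) (coord2_ge0 k) _ H.
  rewrite addr_gt0 ?ltr0n// => /(_ isT).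
  rewrite -/(gamma_factor _) => <-.
  pose g (l : 'I_n) (x : R) := (if l == k then x ^+ 2 else 1) * gauss_fun x.
  under eq_integral => z _.
    rewrite expRN_sqr_enorm (_ : _ * _ = \prod_l g l (z ord0 l)); last first.
      rewrite /g big_split/=; congr (_ * _).
      by rewrite (bigD1 k)//= eqxx big1 ?mulr1// => l /negbTE ->.
    over.
  rewrite (ge0_integral_rV_prod (g := g)); last 2 first.
  - move=> l; apply: measurable_funM; last exact: measurable_gauss_fun.
    by case: (l == k).
  - by move=> l x; rewrite mulr_ge0 ?gauss_fun_ge0//; case: ifP => // _; exact: sqr_ge0.
  transitivity (\prod_(l < n) (if l == k then K else Num.sqrt pi)%:E)%E.
    apply: eq_bigr => l _; rewrite /g; case: ifP => _; first exact: KE.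
    by under eq_integral do rewrite mul1r; exact: integralT_gauss.
  rewrite prodEFin (bigD1 k)//= eqxx; congr (_ * _)%:E.
  rewrite (eq_bigr (fun _ => Num.sqrt pi)) => [|l /negbTE -> //].
  by rewrite prodr_const cardC1 card_ord.
have M0 k : (0 <= (M k)%:E)%E by rewrite -M_E; apply: integral_ge0 => z _; rewrite lee_fin.
have [x [b [_ b0 _ Eb]]] := ge0_mule_fin (M0 i) (gamma_factor_ge0 _) C0 (E i).
have := E i; rewrite -(E j) Eb -!EFinM => -[].
by apply: mulIf; rewrite gt_eqF.
Qed.

(** The second moments add up to the integral of |z|^2 over the unit ball,
    which [homogeneous_moment] gives for rho = 1 and p = 2. *)
Let sum_M : \sum_i M i = ball_vol * (n%:R / (n%:R + 2)).
Proof.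
have n0 : 0 < n%:R :> R by rewrite ltr0n.
have H1 r : 0 < r -> (\int[leb]_(z in eball r) (cst 1 z)%:E)%E = (r `^ n%:R * ball_vol)%:E.
  exact: vol_eball.
have [_] := @homogeneous_moment R n (cst 1) n%:R measurable_cst1 (fun _ => ler01)
  ball_vol 2 1 n0 (addr_gt0 n0 (ltr0n _ 2)) ltr01 (or_intror (ltr0n _ 2)) H1.
rewrite powR1 mulr1 => <-.
rewrite /Rintegral; under eq_integral => z _.
  rewrite /= mul1r (powR_mulrn 2) ?enorm_ge0// sqr_enorm -sumEFin; over.
rewrite ge0_integral_sum//; last 3 first.
- exact: measurable_eball.
- by move=> i; apply/measurable_EFinP/measurable_funTS; exact: mcoord2.
- by move=> i z _; rewrite lee_fin sqr_ge0.
under [in RHS]eq_bigr do rewrite M_E.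
by rewrite sumEFin.
Qed.

Let M_val i : M i = ball_vol / (n%:R + 2).
Proof.
have n0 : 0 < n%:R :> R by rewrite ltr0n.
have := sum_M; rewrite (eq_bigr (fun _ => M i)) => [|j _]; last exact: M_all_eq.
rewrite sumr_const card_ord -[M i *+ n]mulr_natl mulrCA => /mulfI -> //.
by rewrite gt_eqF.
Qed.

Lemma coord_moment (i : 'I_n) (beta d : R) : beta < n%:R + 2 -> 0 < d ->
  leb.-integrable (eball d) (EFin \o (fun z : 'rV[R]_n => z ord0 i ^+ 2 * enorm z `^ (- beta))) /\
  (\int[leb]_(z in eball d) (z ord0 i ^+ 2 * enorm z `^ (- beta)))%R =
    ball_vol / (n%:R + 2 - beta) * d `^ (n%:R + 2 - beta).
Proof.
move=> hb d0.
have n0 : 0 < n%:R + 2 :> R by rewrite addr_gt0 ?ltr0n.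
have nb : 0 < n%:R + 2 - beta by rewrite subr_gt0.
have z0 : coord2 i 0 = 0 by rewrite /coord2 mxE expr0n.
have [? ->] := homogeneous_moment (mcoord2 i) (coord2_ge0 i) n0 nb d0 (or_introl z0)
  (@coord2_eball i).
split => //; rewrite M_val; congr (_ * _); field.
by rewrite !gt_eqF.
Qed.

(** |z|^p is the sum of the z_i^2 |z|^(p - 2), except at 0 when p = 0. *)
Lemma radial_moment (p d : R) : 0 < n%:R + p -> 0 < d ->
  leb.-integrable (eball d) (EFin \o (fun z : 'rV[R]_n => enorm z `^ p)) /\
  (\int[leb]_(z in eball d) (enorm z `^ p))%R =
    n%:R * ball_vol / (n%:R + p) * d `^ (n%:R + p).
Proof.
move=> np d0.
have n0 : 0 < n%:R :> R by rewrite ltr0n.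
have n20 : 0 < n%:R + 2 :> R by rewrite addr_gt0.
have [p0|p_neq0] := eqVneq p 0.
  rewrite p0 addr0; under eq_Rintegral do rewrite powRr0.
  rewrite /Rintegral vol_eball//; split; last first.
    by rewrite /= mulrC; congr (_ * _); field; rewrite gt_eqF.
  apply/integrableP; split.
    apply: measurable_funTS; apply/measurable_EFinP.
    by apply: (measurableT_comp (measurable_powR _)); exact: measurable_enorm.
  under eq_integral do rewrite /= powRr0 normr1.
  by rewrite vol_eball// ltry.
have E z : enorm z `^ p = \sum_i (z ord0 i ^+ 2 * enorm z `^ (- (2 - p))) :> R.
  rewrite -mulr_suml -sqr_enorm opprB.
  have [->|z0] := eqVneq (enorm z) 0; first by rewrite powR0// expr0n mul0r.
  rewrite -powR_mulrn ?enorm_ge0// -powRD; first by rewrite addrC subrK.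
  by rewrite z0 implybT.
have h2p : 2 - p < n%:R + 2 by lra.
have I i := @coord_moment i (2 - p) d h2p d0.
split.
  rewrite (_ : EFin \o _ = (fun z => \sum_i (EFin \o
      (fun z : 'rV[R]_n => z ord0 i ^+ 2 * enorm z `^ (- (2 - p)))%R) z)%E).
    apply: integrable_sum; first exact: measurable_eball.
    by move=> i _; case: (I i).
  by apply/funext => z; rewrite /= E sumEFin.
rewrite /Rintegral; under eq_integral do rewrite E -sumEFin.
rewrite (integral_sum (measurable_eball _)); last first.
  by move=> i; case: (I i).
have S i : (\int[leb]_(z in eball d) (z ord0 i ^+ 2 * enorm z `^ (- (2 - p)))%:E)%E =
   (ball_vol / (n%:R + p) * d `^ (n%:R + p))%:E.
  have [J1 J2] := I i; rewrite -[LHS]fineK; last first.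
    exact: (integrable_fin_num (measurable_eball _) J1).
  rewrite -/(Rintegral _ _ _) J2.
  by have -> : n%:R + 2 - (2 - p) = n%:R + p by ring.
rewrite (eq_bigr _ (fun i _ => S i)) sumEFin /= sumr_const card_ord -[LHS]mulr_natl.
by rewrite !mulrA.
Qed.

End moments.

(** * Borel sets of R^n *)

Section borel_rV.
Variables (R : realType) (n : nat).

Let box (c : 'rV[rat]_n * 'rV[rat]_n) : set 'rV[R]_n :=
  [set z | forall i, ratr (c.1 ord0 i) < z ord0 i < ratr (c.2 ord0 i)].

Let measurable_box c : measurable (box c).
Proof.
rewrite (_ : box c = \bigcap_(i in [set: 'I_n])
    ([set z | ratr (c.1 ord0 i) < z ord0 i] `&` [set z | z ord0 i < ratr (c.2 ord0 i)])).
  apply: fin_bigcap_measurable; first exact: finite_finset.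
  move=> i _; apply: measurableI; apply: measurable_lt_set => //; exact: measurable_coord.
apply/seteqP; split => z /= h i.
  by move=> _; have /andP[] := h i.
by apply/andP; have [] := h i I.
Qed.

(** The sigma-algebra is generated by the coordinates; an open set is the
    union of the countably many boxes with rational vertices that it contains. *)
Lemma open_measurable_rV (A : set 'rV[R]_n) : open A -> measurable A.
Proof.
rewrite openE => oA.
rewrite (_ : A = \bigcup_c (if `[< box c `<=` A >] then box c else set0)).
  apply: countable_bigcupT_measurable => // c.
  by case: ifP => _; [exact: measurable_box|exact: measurable0].
apply/seteqP; split => z; last first.
  by move=> [c _]; case: asboolP => // cA /cA.
move=> /[dup] Az /oA; rewrite /interior => /nbhs_ballP[e /= e0 eA].
have [a az] : exists a : 'rV[rat]_n, forall i, ratr (a ord0 i) \in `](z ord0 i - e), (z ord0 i)[%R.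
  have h i : exists q, ratr q \in `](z ord0 i - e), (z ord0 i)[%R.
    by apply: rat_in_itvoo; rewrite ltrBlDr ltrDl.
  by exists (\row_i sval (cid (h i))) => i; rewrite mxE; case: cid.
have [b bz] : exists b : 'rV[rat]_n, forall i, ratr (b ord0 i) \in `](z ord0 i), (z ord0 i + e)[%R.
  have h i : exists q, ratr q \in `](z ord0 i), (z ord0 i + e)[%R.
    by apply: rat_in_itvoo; rewrite ltrDl.
  by exists (\row_i sval (cid (h i))) => i; rewrite mxE; case: cid.
exists (a, b) => //; case: asboolP => [_ i|[]].
  by move: (az i) (bz i); rewrite !in_itv/= => /andP[_ ->] /andP[-> _].
move=> y yab; apply: eA; split => // i j; rewrite [i]ord1 /ball/= ltr_norml.
move: (az j) (bz j) (yab j); rewrite !in_itv/= => /andP[? ?] /andP[? ?] /andP[? ?].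
by apply/andP; split; lra.
Qed.

Lemma continuous_measurable_rV (f : 'rV[R]_n -> R) :
  continuous f -> measurable_fun setT f.
Proof.
move=> /continuousP cf; apply: (measurability _ (RGenOpens.measurableE R)).
move=> _ [_ [a [b ->] <-]]; rewrite setTI; apply: open_measurable_rV.
exact/cf/interval_open.
Qed.

End borel_rV.

(** * Domination, and sign changes of coordinates *)

Section Rintegral_tools.
Context d (T : measurableType d) (R : realType) (m : {measure set T -> \bar R}).

Lemma dominated_integrable (D : set T) (f g : T -> R) :
  measurable D -> measurable_fun setT f ->
  (forall x, D x -> `|f x| <= g x) ->
  m.-integrable D (EFin \o g) -> m.-integrable D (EFin \o f).
Proof.
move=> mD mf fg ig; apply: (le_integrable mD _ _ ig).
  by apply/measurable_EFinP; exact: measurable_funS mf.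
by move=> x Dx; rewrite /= lee_fin (le_trans (fg _ Dx))// ler_norm.
Qed.

Lemma dominated_Rintegral (D : set T) (f g : T -> R) :
  measurable D -> measurable_fun setT f ->
  (forall x, D x -> `|f x| <= g x) -> m.-integrable D (EFin \o g) ->
  `| \int[m]_(x in D) f x | <= \int[m]_(x in D) g x.
Proof.
move=> mD mf fg ig; have i_f := dominated_integrable mD mf fg ig.
apply: (le_trans (le_normr_Rintegral mD i_f)).
by apply: le_Rintegral => //; exact: integrable_norm.
Qed.

Lemma subset_Rintegral (A B : set T) (f : T -> R) :
  measurable A -> measurable B -> A `<=` B -> (forall x, B x -> 0 <= f x) ->
  m.-integrable B (EFin \o f) ->
  \int[m]_(x in A) f x <= \int[m]_(x in B) f x.
Proof.
move=> mA mB AB f0 i_f; apply: fine_le.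
- by apply: integrable_fin_num => //; exact: integrableS i_f.
- exact: integrable_fin_num.
- apply: ge0_subset_integral => //; exact: measurable_int i_f.
Qed.

Lemma Rintegral_sumr n (D : set T) (f : 'I_n -> T -> R) : measurable D ->
  (forall i, m.-integrable D (EFin \o f i)) ->
  \int[m]_(x in D) (\sum_i f i x) = \sum_i \int[m]_(x in D) f i x.
Proof.
move=> mD i_f; rewrite /Rintegral; under eq_integral do rewrite -sumEFin.
rewrite (integral_sum mD)//.
rewrite (eq_bigr (fun i => (\int[m]_(x in D) f i x)%:E)) ?sumEFin// => i _.
by rewrite /Rintegral fineK//; exact: (integrable_fin_num mD (i_f i)).
Qed.

End Rintegral_tools.

Section symmetries.
Variables (R : realType) (n : nat).
Local Notation leb := (@lebesgue_rV R n).

Lemma ge0_integral_rV_sign (s : 'I_n -> R) (D : set 'rV[R]_n)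
    (g : 'rV[R]_n -> \bar R) :
  (forall i, s i ^+ 2 = 1) -> measurable D -> measurable_fun setT g ->
  (forall z, (0 <= g z)%E) -> (forall z, D (rV_scale s z) <-> D z) ->
  (\int[leb]_(z in D) g (rV_scale s z) = \int[leb]_(z in D) g z)%E.
Proof.
move=> s1 mD mg g0 Ds.
have s_neq0 i : s i != 0.
  by apply/eqP => si0; have := s1 i; rewrite si0 expr0n => /eqP; rewrite eq_sym oner_eq0.
have s_norm i : `|s i| = 1.
  by apply/eqP; rewrite -sqrp_eq1// real_normK ?num_real// s1.
have := @ge0_integral_rV_scale R n s (g \_ D) s_neq0.
rewrite big1 ?invr1 ?mul1e => [|i _]; last exact: s_norm.
move=> H; rewrite [RHS]integral_mkcond -H; last 2 first.
- by apply/(measurable_restrictT _ mD); exact: measurable_funTS.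
- by move=> z; rewrite patchE; case: ifP.
rewrite [LHS]integral_mkcond; apply: eq_integral => z _; rewrite !patchE.
have -> : (rV_scale s z \in D) = (z \in D).
  by apply/idP/idP; rewrite !inE => /Ds.
by [].
Qed.

Lemma Rintegral_rV_sign (s : 'I_n -> R) (D : set 'rV[R]_n) (f : 'rV[R]_n -> R) :
  (forall i, s i ^+ 2 = 1) -> measurable D -> measurable_fun setT f ->
  (forall z, D (rV_scale s z) <-> D z) ->
  \int[leb]_(z in D) f (rV_scale s z) = \int[leb]_(z in D) f z.
Proof.
move=> s1 mD /measurable_EFinP mf Ds.
congr fine; rewrite integralE [RHS]integralE.
rewrite -(ge0_integral_rV_sign s1 mD (measurable_funepos mf) _ Ds)//.
rewrite -(ge0_integral_rV_sign s1 mD (measurable_funeneg mf) _ Ds)//.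
by congr (_ - _)%E; apply: eq_integral => z _; rewrite ?funeposE ?funenegE.
Qed.

Let oppE (z : 'rV[R]_n) : - z = rV_scale (fun=> -1 : R) z.
Proof. by apply/rowP => i; rewrite !mxE mulN1r. Qed.

Lemma ge0_integral_opp (D : set 'rV[R]_n) (g : 'rV[R]_n -> \bar R) :
  measurable D -> measurable_fun setT g -> (forall z, (0 <= g z)%E) ->
  (forall z, D (- z) <-> D z) ->
  (\int[leb]_(z in D) g (- z)%R = \int[leb]_(z in D) g z)%E.
Proof.
move=> mD mg g0 DN; under eq_integral do rewrite oppE.
apply: ge0_integral_rV_sign => // [i|z]; first by rewrite sqrrN expr1n.
by rewrite -oppE.
Qed.

Lemma Rintegral_opp (D : set 'rV[R]_n) (f : 'rV[R]_n -> R) :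
  measurable D -> measurable_fun setT f -> (forall z, D (- z) <-> D z) ->
  \int[leb]_(z in D) f (- z) = \int[leb]_(z in D) f z.
Proof.
move=> mD mf DN; under eq_Rintegral do rewrite oppE.
apply: Rintegral_rV_sign => // [i|z]; first by rewrite sqrrN expr1n.
by rewrite -oppE.
Qed.

Lemma measurable_opp_rV : measurable_fun setT (-%R : 'rV[R]_n -> 'rV[R]_n).
Proof.
apply: measurable_fun_rVP => i.
rewrite (_ : _ \o _ = fun z => - @rV_coord R n i z).
  by apply: measurableT_comp => //; exact: measurable_rV_coord.
by apply/funext => z; rewrite /= /rV_coord mxE.
Qed.

(** The integrand changes sign with the i-th coordinate. *)
Lemma Rintegral_odd_coord (i k : 'I_n) (beta d : R) : i != k ->
  leb.-integrable (eball d) (EFin \o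
    (fun z : 'rV[R]_n => z ord0 i * z ord0 k * enorm z `^ (- beta))) ->
  \int[leb]_(z in eball d) (z ord0 i * z ord0 k * enorm z `^ (- beta)) = 0.
Proof.
move=> ik itg.
pose s (l : 'I_n) : R := if l == i then -1 else 1.
have s1 l : s l ^+ 2 = 1 by rewrite /s; case: ifP => _; rewrite ?sqrrN expr1n.
pose f (z : 'rV[R]_n) := z ord0 i * z ord0 k * enorm z `^ (- beta).
have mf : measurable_fun setT f.
  apply: measurable_funM; first by apply: measurable_funM; exact: measurable_coord.
  by apply: (measurableT_comp (measurable_powR _)); exact: measurable_enorm.
have mB := @measurable_eball R n d.
have := Rintegral_rV_sign s1 mB mf.
under eq_Rintegral => z _.
  rewrite (_ : f _ = -1 * f z); last first.
    rewrite /f enorm_rV_scale_sign// !mxE /s eqxx [k == i]eq_sym (negbTE ik).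
    by ring.
  over.
rewrite RintegralZl// -/f => /(_ _)/eqP.
rewrite mulN1r eq_sym -subr_eq0 opprK -mulr2n mulrn_eq0/=; move=> H.
apply/eqP; apply: H => z.
by rewrite /eball/= enorm_rV_scale_sign.
Qed.

End symmetries.

(** * The ball integral as an integral of the even part *)

Section rV_norm.
Variables (R : realType) (n : nat).

Lemma rV_norm_leP (x : 'rV[R]_n) (e : R) : 0 <= e ->
  (`|x| <= e) <-> (forall i, `|x ord0 i| <= e).
Proof.
move=> e0; rewrite [`|x|]mx_normrE; split.
  by move=> /bigmax_leP[_ h] i; exact: (h (ord0, i)).
move=> h; apply/bigmax_leP; split => // -[i j] _ /=.
by rewrite [i]ord1.
Qed.

Lemma cvg_rV (T : Type) (F : set_system T) (f : T -> 'rV[R]_n) (l : 'rV[R]_n) :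
  Filter F -> (forall i, f x ord0 i @[x --> F] --> l ord0 i) -> f x @[x --> F] --> l.
Proof.
move=> FF h; apply/cvgrPdist_le => e e0.
have : \forall x \near F, forall i, `|l ord0 i - f x ord0 i| <= e.
  by apply: filter_forall => i; move/cvgrPdist_le: (h i); exact.
apply: filterS => x hx; apply/(rV_norm_leP _ (ltW e0)) => i.
by rewrite !mxE; exact: hx.
Qed.

Lemma cvg_rV_bound (T : Type) (F : set_system T) (FF : Filter F)
    (f : T -> 'rV[R]_n) (l : 'rV[R]_n) (b : T -> R) :
  b t @[t --> F] --> 0 ->
  (\forall t \near F, forall i, `|f t ord0 i - l ord0 i| <= b t) ->
  f t @[t --> F] --> l.
Proof.
move=> b0 fb; apply: cvg_rV => i; apply/cvgrPdist_le => e e0.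
have be : \forall t \near F, `|0 - b t| <= e by move/cvgrPdist_le: b0; apply.
apply: filterS2 fb be => t /(_ i) h1; rewrite sub0r normrN distrC => h2.
exact: le_trans h1 (le_trans (ler_norm _) h2).
Qed.

End rV_norm.

Section symmetrisation.
Variables (R : realType) (n : nat).
Hypothesis n_gt0 : (0 < n)%N.
Local Notation leb := (@lebesgue_rV R n).
Implicit Types (q z : 'rV[R]_n) (phi : 'rV[R]_n -> R).

Definition even_part phi : 'rV[R]_n -> R := fun q => (phi q + phi (- q)) / 2.

Lemma measurable_even_part phi : measurable_fun setT phi ->
  measurable_fun setT (even_part phi).
Proof.
move=> mphi; apply: measurable_funM => //; apply: measurable_funD => //.
by apply: (measurableT_comp mphi); exact: measurable_opp_rV.
Qed.

Lemma Rintegral_even_part (D : set 'rV[R]_n) phi :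
  measurable D -> (forall z, D (- z) <-> D z) -> measurable_fun setT phi ->
  leb.-integrable D (EFin \o phi) ->
  \int[leb]_(q in D) phi q = \int[leb]_(q in D) even_part phi q.
Proof.
move=> mD DN mphi ip.
have mphiN : measurable_fun setT (fun q => phi (- q)).
  by apply: (measurableT_comp mphi); exact: measurable_opp_rV.
have ipN : leb.-integrable D (EFin \o (fun q => phi (- q))).
  apply/integrableP; split.
    by apply/measurable_EFinP; exact: measurable_funS mphiN.
  have mN : measurable_fun setT (fun q => `|phi q|%:E).
    by apply/measurable_EFinP; exact: measurableT_comp.
  rewrite (ge0_integral_opp mD mN) => [|//|//].
  by case/integrableP: ip.
rewrite /even_part RintegralZr//; last first.
  exact: (integrableD mD ip ipN).
by rewrite RintegralD// Rintegral_opp//; field.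
Qed.

(** On an annulus, |q| > e makes phi itself integrable, so phi may be replaced
    there by its even part; what is missing from the ball is then at most the
    integral of C |q|^(2 - beta) over a ball of radius 2 e, which is of order
    e^(n + 2 - beta). *)
Lemma annulus_integral_cvg phi (beta d H C : R) :
  beta < n%:R + 2 -> 0 < d -> measurable_fun setT phi ->
  (forall q, eball d q -> `|phi q| <= H * enorm q `^ (1 - beta)) ->
  (forall q, eball d q -> `|phi q + phi (- q)| <= C * enorm q `^ (2 - beta)) ->
  \int[leb]_(q in annulus e d) phi q @[e --> 0^'+] -->
    \int[leb]_(q in eball d) even_part phi q.
Proof.
move=> hb d0 mphi hH hC.
have g_gt0 : 0 < n%:R + (2 - beta) by lra.
have mB r : measurable (@eball R n r) by exact: measurable_eball.
have mA e : measurable (@annulus R n e d) by exact: measurable_annulus.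
have me := measurable_even_part mphi.
have mpow p : measurable_fun setT (fun q => enorm q `^ p : R).
  by apply: (measurableT_comp (measurable_powR _)); exact: measurable_enorm.
have AB e : annulus e d `<=` @eball R n d by move=> z /= /andP[].
have hev q : eball d q -> `|even_part phi q| <= C * enorm q `^ (2 - beta).
  move=> dq; have := hC q dq; rewrite /even_part normrM [`|2^-1|]ger0_norm// => h.
  have := normr_ge0 (phi q + phi (- q)); lra.
have ipow K r : 0 < r ->
    leb.-integrable (eball r) (EFin \o (fun q => K * enorm q `^ (2 - beta))).
  move=> r0; have [ir _] := radial_moment n_gt0 g_gt0 r0.
  exact: (@integrableZl _ _ _ leb _ (mB r) K _ ir).
have iev : leb.-integrable (eball d) (EFin \o even_part phi).
  exact: dominated_integrable me hev (ipow C _ d0).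
pose L := `|C| * (n%:R * ball_vol R n / (n%:R + (2 - beta)) * 2 `^ (n%:R + (2 - beta))).
have main e : 0 < e -> e < d ->
    `|\int[leb]_(q in eball d) even_part phi q - \int[leb]_(q in annulus e d) phi q|
      <= L * e `^ (n%:R + (2 - beta)).
  move=> e0 ed.
  have ia : leb.-integrable (annulus e d) (EFin \o phi).
    apply: (@dominated_integrable _ _ _ leb _ _
        (fun q => `|H| / e * enorm q `^ (2 - beta)) (mA e) mphi).
      move=> q /[dup] /AB dq /andP[eq _]; apply: le_trans (hH q dq) _.
      have q0 : 0 < enorm q by exact: lt_trans eq.
      have -> : enorm q `^ (1 - beta) = (enorm q)^-1 * enorm q `^ (2 - beta).
        rewrite -powR_inv1 ?enorm_ge0// -powRD; last by rewrite (gt_eqF q0) implybT.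
        by congr (_ `^ _); ring.
      rewrite mulrA ler_wpM2r ?powR_ge0//.
      apply: (@le_trans _ _ (`|H| / enorm q)).
        by rewrite ler_wpM2r ?invr_ge0 ?enorm_ge0// ler_norm.
      by rewrite ler_wpM2l// lef_pV2 ?posrE// ltW.
    by apply: integrableS (ipow _ _ d0).
  rewrite (Rintegral_even_part (mA e))//; last first.
    by move=> z; rewrite /annulus/= enormN.
  have mDA : measurable (@eball R n d `\` annulus e d) by exact: (measurableD (mB d) (mA e)).
  rewrite -[X in \int[leb]_(q in X) even_part phi q - _](setDUK (@AB e)).
  rewrite Rintegral_setU//; last 2 first.
  - by rewrite setDUK.
  - by apply/disj_setPS => z [? []].
  rewrite addrC addKr.
  apply: (@le_trans _ _ (\int[leb]_(q in eball d `\` annulus e d) (`|C| * enorm q `^ (2 - beta)))).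
    apply: dominated_Rintegral => //.
    - move=> q [dq _]; apply: le_trans (hev q dq) _.
      by rewrite ler_wpM2r ?powR_ge0// ler_norm.
    - by apply: integrableS (ipow _ _ d0) => // z [].
  have e2 : 0 < 2 * e by rewrite mulr_gt0.
  apply: (@le_trans _ _ (\int[leb]_(q in eball (2 * e)) (`|C| * enorm q `^ (2 - beta)))).
    apply: subset_Rintegral => //.
    - move=> z [/= dz /negP nz]; rewrite /eball/=; move: nz.
      rewrite /annulus/= dz andbT -leNgt => /le_lt_trans; apply.
      by rewrite ltr_pMl// ltr1n.
    - by move=> z _; rewrite mulr_ge0 ?powR_ge0.
    - exact: ipow.
  have [i2 E2] := radial_moment n_gt0 g_gt0 e2.
  rewrite (RintegralZl _ (mB _) i2) E2 powRM ?(ltW e0)//.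
  rewrite le_eqVlt; apply/orP; left; apply/eqP.
  by rewrite /L !mulrA.
have L0 : L * e `^ (n%:R + (2 - beta)) @[e --> 0^'+] --> 0.
  by rewrite -[X in _ --> X](mulr0 L); apply: cvgM; [exact: cvg_cst|exact: powR_cvg0].
apply/cvgrPdist_le => eps eps0.
have L1 : \forall e \near 0^'+, `|0 - L * e `^ (n%:R + (2 - beta))| <= eps.
  by move/cvgrPdist_le: L0; apply.
near=> e.
have e0 : 0 < e by near: e; exact: nbhs_right_gt.
have ed : e < d by near: e; exact: nbhs_right_lt.
apply: le_trans (main e e0 ed) _.
apply: (@le_trans _ _ `|0 - L * e `^ (n%:R + (2 - beta))|); last by near: e.
by rewrite sub0r normrN ler_norm.
Unshelve. all: by end_near. Qed.

(** The two hypotheses are the sizes of K_i(q) f(q) for bounded f and of its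
    even part for Lipschitz f; the first one gives integrability below n + 1,
    the second one everywhere below n + 2. *)
Lemma ball_integral_even_part (beta d H C : R) (U : 'rV[R]_n -> 'rV[R]_n) :
  beta < n%:R + 2 -> 0 < d ->
  (forall i, measurable_fun setT (fun q => U q ord0 i)) ->
  (forall i q, eball d q -> `|U q ord0 i| <= H * enorm q `^ (1 - beta)) ->
  (forall i q, eball d q ->
    `|U q ord0 i + U (- q) ord0 i| <= C * enorm q `^ (2 - beta)) ->
  ball_integral d beta U =
  \row_i \int[leb]_(q in eball d) even_part (fun q => U q ord0 i) q.
Proof.
move=> hb d0 mU hH hC; rewrite /ball_integral; case: ifPn => [b1|_].
  apply/rowP => i; rewrite !mxE; apply: Rintegral_even_part => //.
  - exact: measurable_eball.
  - by move=> z; rewrite /eball/= enormN.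
  - have p0 : 0 < n%:R + (1 - beta) by lra.
    have [ir _] := radial_moment n_gt0 p0 d0.
    apply: (dominated_integrable (measurable_eball _) (mU i) (hH i)).
    exact: (@integrableZl _ _ _ leb _ (measurable_eball _) H _ ir).
apply/cvg_lim; first exact: norm_hausdorff.
apply: cvg_rV => i; under eq_fun do rewrite mxE.
rewrite mxE; exact: (annulus_integral_cvg hb d0 (mU i) (hH i) (hC i)).
Qed.


End symmetrisation.

(** * Mean value theorems along the coordinates *)

Section mean_value.
Variables (R : realType) (n : nat).
Implicit Types (f : 'rV[R]_n -> R) (x a h : 'rV[R]_n).
Local Notation e_ k := (delta_mx ord0 k : 'rV[R]_n).

Lemma is_derive_line f x (v : 'rV[R]_n) (s : R) : derivable f (x + s *: v) v ->
  is_derive s 1 (fun t : R => f (x + t *: v)) ('D_v f (x + s *: v)).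
Proof.
move=> df.
have E : (fun h : R => h^-1 *: (((fun t : R => f (x + t *: v)) \o shift s) (h *: 1)
           - f (x + s *: v))) =
         (fun h : R => h^-1 *: ((f \o shift (x + s *: v)) (h *: v) - f (x + s *: v))).
  apply/funext => h /=; congr (_ *: (f _ - _)).
  by rewrite /shift/= [h *: 1]mulr1 scalerDl addrCA.
apply: DeriveDef; first by rewrite /derivable E.
by rewrite /derive E.
Qed.

Lemma partial_mean_value f k x (t : R) :
  (forall y, derivable f y (e_ k)) ->
  exists2 th : R, `|th| <= `|t| & f (x + t *: e_ k) - f x = t * partial k f (x + th *: e_ k).
Proof.
move=> df.
have key y (s : R) : 0 <= s -> exists2 th : R, 0 <= th <= s &
    f (y + s *: e_ k) - f y = s * partial k f (y + th *: e_ k).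
  move=> s0; have D r := is_derive_line (x := y) (s := r) (df _).
  have [r rI E] : exists2 c : R, c \in `[0, s]%R &
      f (y + s *: e_ k) - f (y + (0 : R) *: e_ k) = partial k f (y + c *: e_ k) * (s - 0).
    apply: (@MVT_segment R (fun t : R => f (y + t *: e_ k))
       (fun t => partial k f (y + t *: e_ k)) 0 s s0).
    apply: continuous_subspaceT => r.
    apply: differentiable_continuous; apply/derivable1_diffP.
    by have [] := D r.
  exists r; first by rewrite in_itv/= in rI.
  by move: E; rewrite scale0r addr0 subr0 mulrC.
have [t0|t0] := leP 0 t.
  by have [th /andP[th0 tht] E] := key x t t0; exists th => //; rewrite !ger0_norm.
have t0' : 0 <= - t by rewrite oppr_ge0 ltW.
have [th /andP[th0 tht] E] := key (x + t *: e_ k) (- t) t0'.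
exists (t + th); first by rewrite ler0_norm ?[`|t|]ltr0_norm//; lra.
move: E; rewrite -addrA -scalerDl subrr scale0r addr0 -addrA -scalerDl => E.
by rewrite -opprB E mulNr opprK.
Qed.

(** Changing one coordinate at a time needs the partial derivatives only, and
    not the differentiability of f; each intermediate point keeps, in the i-th
    coordinate, within |h_i| of a. *)
Lemma coordinatewise_mean_value f a h :
  (forall k y, derivable f y (e_ k)) ->
  exists xi : 'I_n -> 'rV[R]_n,
    (forall k i, `|xi k ord0 i - a ord0 i| <= `|h ord0 i|) /\
    f (a + h) - f a = \sum_k h ord0 k * partial k f (xi k).
Proof.
move=> df.
(* the first m coordinates of h *)
pose tr (m : nat) : 'rV[R]_n := \row_i (if (i < m)%N then h ord0 i else 0).
have trS (k : 'I_n) : tr k.+1 = tr k + h ord0 k *: e_ k.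
  apply/rowP => i; rewrite !mxE eqxx/= ltnS leq_eqVlt.
  have [->|ik] := eqVneq i k; first by rewrite eqxx ltnn add0r mulr1.
  by rewrite (negbTE (_ : (i != k :> nat)%N)) //= mulr0 addr0.
have H (k : 'I_n) : exists th : R, `|th| <= `|h ord0 k| /\
    f (a + tr k.+1) - f (a + tr k) = h ord0 k * partial k f (a + tr k + th *: e_ k).
  have [th thh E] := partial_mean_value (a + tr k) (h ord0 k) (df k).
  by exists th; split => //; rewrite trS addrA.
have [th thP] := choice H.
exists (fun k : 'I_n => a + tr k + th k *: e_ k); split.
  move=> k i; have [thh _] := thP k; rewrite !mxE eqxx/= -addrA addrAC subrr add0r.
  have [->|ik] := eqVneq i k; first by rewrite ltnn add0r mulr1.
  by rewrite mulr0 addr0; case: ifP; rewrite ?normr0.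
rewrite (_ : f (a + h) - f a = f (a + tr n) - f (a + tr 0%N)); last first.
  congr (f _ - f _); first by congr (_ + _); apply/rowP => i; rewrite mxE ltn_ord.
  by rewrite (_ : tr 0%N = 0) ?addr0//; apply/rowP => i; rewrite !mxE ltn0.
rewrite -(telescope_sumr (fun m => f (a + tr m)) (leq0n n)) big_mkord.
by apply: eq_bigr => k _; have [_ ->] := thP k.
Qed.

Lemma partial_bound_increment f (a h : 'rV[R]_n) (M rad : R) x :
  (forall k y, derivable f y (e_ k)) ->
  (forall i, `|a ord0 i - x ord0 i| + `|h ord0 i| <= rad) ->
  (forall (y : 'rV[R]_n) k, (forall i, `|y ord0 i - x ord0 i| <= rad) -> `|partial k f y| <= M) ->
  `|f (a + h) - f a| <= (\sum_k `|h ord0 k|) * M.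
Proof.
move=> df hr hM; have [xi [xiB ->]] := coordinatewise_mean_value a h df.
apply: (le_trans (ler_norm_sum _ _ _)).
rewrite mulr_suml; apply: ler_sum => k _; rewrite normrM ler_wpM2l//.
apply: hM => i; apply: le_trans (hr i).
rewrite (_ : _ - _ = (a ord0 i - x ord0 i) + (xi k ord0 i - a ord0 i)); last by ring.
by apply: (le_trans (ler_normD _ _)); rewrite lerD2l.
Qed.

Lemma quotient_shift f (w y v : 'rV[R]_n) :
  (fun t : R => t^-1 *: (((fun z => f (z + w)) \o shift y) (t *: v) - f (y + w))) =
  (fun t : R => t^-1 *: ((f \o shift (y + w)) (t *: v) - f (y + w))).
Proof. by apply/funext => t; rewrite /= /shift addrA. Qed.

Lemma partial_shift k f (w y : 'rV[R]_n) :
  partial k (fun z => f (z + w)) y = partial k f (y + w).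
Proof. by rewrite /partial /derive quotient_shift. Qed.

Lemma derivable_shift k f (w y : 'rV[R]_n) : derivable f (y + w) (e_ k) ->
  derivable (fun z => f (z + w)) y (e_ k).
Proof. by rewrite /derivable quotient_shift. Qed.

Lemma continuous_bounded_box (I : finType) (g : I -> 'rV[R]_n -> R) x (r : R) :
  (forall i, continuous (g i)) ->
  exists2 M : R, 0 <= M &
    forall i (y : 'rV[R]_n), (forall j, `|y ord0 j - x ord0 j| <= r) -> `|g i y| <= M.
Proof.
move=> cg.
have H i : exists M : R, forall y : 'rV[R]_n,
    (forall j, `|y ord0 j - x ord0 j| <= r) -> `|g i y| <= M.
  pose A := [set y : 'rV[R]_n | forall j, `[x ord0 j - r, x ord0 j + r]%classic (y ord0 j)].
  have cA : compact A.
    apply: (@rV_compact R n (fun j => `[x ord0 j - r, x ord0 j + r]%classic)) => j.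
    exact: segment_compact.
  have : compact (g i @` A).
    by apply: continuous_compact => //; apply: continuous_subspaceT; exact: cg.
  move=> /compact_bounded[M [_ hM]]; exists (M + 1) => y hy.
  apply: (hM (M + 1)); first by rewrite ltrDl.
  exists y => // j /=; rewrite in_itv/=; have := hy j; rewrite ler_norml => /andP[? ?].
  by apply/andP; split; lra.
have [M hM] := choice H.
exists (\sum_i `|M i|); first by rewrite sumr_ge0.
move=> i y hy; apply: (le_trans (hM i y hy)); rewrite (bigD1 i)//=.
by rewrite (le_trans (ler_norm _))// lerDl sumr_ge0.
Qed.

End mean_value.

(** * Second differences of a C^3 function *)

Section second_difference.
Variables (R : realType) (n : nat).
Implicit Types (f : 'rV[R]_n -> R) (x w q : 'rV[R]_n).

Definition second_diff f x w q : R :=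
  (f (x + w + q) - f (x + w - q)) - (f (x - w + q) - f (x - w - q)).

(** The second derivative of f at x in the directions w and q, in the order of
    differentiation in which grad (div u) presents it. *)
Definition hess_form f x w q : R :=
  \sum_l q ord0 l * \sum_k w ord0 k * partial k (partial l f) x.

(** The second difference is the increment between x - q and x + q of
    y -> f (y + w) - f (y - w), whose partial derivatives are increments of those
    of f between points that differ by 2 w. *)
Lemma second_diff_mean_value f x w q :
  (forall k y, derivable f y (delta_mx ord0 k)) ->
  (forall l k y, derivable (partial l f) y (delta_mx ord0 k)) ->
  exists zeta : 'I_n -> 'I_n -> 'rV[R]_n,
    (forall l k i, `|zeta l k ord0 i - x ord0 i| <= 3 * (enorm w + enorm q)) /\
    second_diff f x w q =
      4 * \sum_l q ord0 l * \sum_k w ord0 k * partial k (partial l f) (zeta l k).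
Proof.
move=> df d2f.
pose g y := f (y + w) - f (y + - w).
have dg l y : derivable g y (delta_mx ord0 l).
  by apply: derivableB; apply: derivable_shift; exact: df.
have pg l y : partial l g y = partial l f (y + w) - partial l f (y + - w).
  rewrite -!partial_shift /partial /g.
  by rewrite (deriveB (derivable_shift (df _ _)) (derivable_shift (df _ _))).
have [xi [xiB xiE]] := coordinatewise_mean_value (x - q) (2 *: q) dg.
have H l : exists z : 'I_n -> 'rV[R]_n,
    (forall k i, `|z k ord0 i - (xi l - w) ord0 i| <= `|(2 *: w) ord0 i|) /\
    partial l f (xi l - w + 2 *: w) - partial l f (xi l - w) =
      \sum_k (2 *: w) ord0 k * partial k (partial l f) (z k).
  exact: coordinatewise_mean_value.
have [z zP] := choice H.
exists z; split.
  move=> l k i; have [/(_ k i) + _] := zP l; have := xiB l i; rewrite !mxE.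
  rewrite !normrM [`|2|]ger0_norm// => /ler_normlP[? ?] /ler_normlP[? ?].
  have /ler_normlP[? ?] := lexx `|w ord0 i|; have /ler_normlP[? ?] := lexx `|q ord0 i|.
  have ? := coord_le_enorm w i; have ? := coord_le_enorm q i.
  by apply/ler_normlP; split; lra.
have -> : second_diff f x w q = g (x - q + 2 *: q) - g (x - q).
  have -> : x - q + 2 *: q = x + q.
    by apply/rowP => i; rewrite !mxE; ring.
  rewrite /second_diff /g.
  rewrite -[x + w + q]addrA [w + q]addrC addrA.
  rewrite -[x + w - q]addrA [w - q]addrC addrA.
  rewrite -[x - w + q]addrA [- w + q]addrC addrA.
  rewrite -[x - w - q]addrA [- w - q]addrC addrA.
  by ring.
rewrite xiE mulr_sumr; apply: eq_bigr => l _; rewrite pg mxE.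
have [_ +] := zP l; have -> : xi l - w + 2 *: w = xi l + w.
  by apply/rowP => i; rewrite !mxE; ring.
move=> ->; rewrite [4 * _]mulrA.
have -> : 4 * q ord0 l = 2 * q ord0 l * 2 by ring.
rewrite -[RHS]mulrA; congr (_ * _); rewrite mulr_sumr; apply: eq_bigr => k _.
by rewrite mxE mulrA.
Qed.

Lemma Ck1_derivable f m : Ck m.+1 f -> forall k y, derivable f y (delta_mx ord0 k).
Proof. by move=> [_ h] k y; have [] := h k. Qed.

Lemma Ck_partial f m k : Ck m.+1 f -> Ck m (partial k f).
Proof. by move=> [_ h]; have [] := h k. Qed.

Lemma Ck_continuous f m : Ck m f -> continuous f.
Proof. by case: m => [|m] []. Qed.

Lemma sum_le_natmul (F : 'I_n -> R) (c : R) :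
  (forall k, F k <= c) -> \sum_k F k <= n%:R * c.
Proof.
move=> Fc; rewrite mulr_natl -[X in _ *+ X]card_ord -sumr_const.
exact: ler_sum.
Qed.

(** The third derivatives are bounded on the box of radius 6 r around x, which
    contains all the intermediate points of the mean value theorems; they
    control the variation of the second derivatives. *)
Lemma C3_bounds f x (r : R) : Ck 3 f -> 0 < r ->
  exists2 C : R, 0 <= C & forall w q, enorm w < r -> enorm q < r ->
    [/\ `|f (x + w + q)| <= C,
        `|f (x + w + q) - f (x + w - q)| <= C * enorm q &
        `|second_diff f x w q - 4 * hess_form f x w q|
          <= C * (enorm w * enorm q * (enorm w + enorm q))].
Proof.
move=> cf r0.
have c1 k := Ck_partial k cf; have c2 k l := Ck_partial k (c1 l).
have c3 m k l := Ck_partial m (c2 k l).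
(* all points have coordinates within 3 (|w| + |q|) < 6 r of those of x *)
have [M0 M00 hM0] := @continuous_bounded_box R n unit (fun=> f) x (6 * r)
  (fun=> Ck_continuous cf).
have [M1 M10 hM1] := @continuous_bounded_box R n 'I_n (fun k => partial k f) x (6 * r)
  (fun k => Ck_continuous (c1 k)).
have [M3 M30 hM3] := @continuous_bounded_box R n ('I_n * 'I_n * 'I_n)%type
  (fun p => partial p.1.1 (partial p.1.2 (partial p.2 f))) x (6 * r)
  (fun p => Ck_continuous (c3 p.1.1 p.1.2 p.2)).
pose N : R := n%:R; have N0 : 0 <= N by rewrite ler0n.
have C1 : 0 <= 2 * N * M1 by rewrite !mulr_ge0.
have C3 : 0 <= 12 * N ^+ 3 * M3 by rewrite !mulr_ge0// exprn_ge0.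
exists (M0 + 2 * N * M1 + 12 * N ^+ 3 * M3); first by rewrite !addr_ge0.
move=> w q wr qr; have w0 := enorm_ge0 w; have q0 := enorm_ge0 q.
have abs_bound i : -enorm w <= w ord0 i <= enorm w /\ -enorm q <= q ord0 i <= enorm q.
  by split; rewrite -ler_norml coord_le_enorm.
split.
- apply: (@le_trans _ _ M0); last lra.
  apply: (hM0 tt) => i; rewrite !mxE ler_norml.
  by have [/andP[? ?] /andP[? ?]] := abs_bound i; apply/andP; split; lra.
- have -> : x + w + q = x + w - q + 2 *: q.
    by apply/rowP => i; rewrite !mxE; ring.
  apply: (@le_trans _ _ ((\sum_k `|(2 *: q) ord0 k|) * M1)).
    apply: (@partial_bound_increment R n f _ _ M1 (6 * r) x).
    - exact: Ck1_derivable cf.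
    - move=> i; rewrite !mxE normrM [`|2|]ger0_norm//.
      have [/andP[? ?] /andP[? ?]] := abs_bound i.
      have h1 : `|x ord0 i + w ord0 i - q ord0 i - x ord0 i| <= enorm w + enorm q.
        by rewrite ler_norml; apply/andP; split; lra.
      by have := coord_le_enorm q i; lra.
    - by move=> y k; exact: hM1.
  have := sum_le_natmul (coord_le_enorm (2 *: q)).
  rewrite enormZ [`|2|]ger0_norm// => h.
  apply: (@le_trans _ _ (N * (2 * enorm q) * M1)); first by rewrite ler_wpM2r.
  rewrite (_ : N * (2 * enorm q) * M1 = 2 * N * M1 * enorm q); last by ring.
  by rewrite ler_wpM2r//; lra.
- have [z [zB ->]] := second_diff_mean_value x w q (Ck1_derivable cf)
    (fun l => Ck1_derivable (c1 l)).
  rewrite -mulrBr normrM [`|4|]ger0_norm// /hess_form -sumrB.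
  pose B := enorm w * enorm q * (N * (3 * (enorm w + enorm q)) * M3).
  have hb l k : `|partial k (partial l f) (z l k) - partial k (partial l f) x| <=
      N * (3 * (enorm w + enorm q)) * M3.
    rewrite -[z l k](subrKC x).
    apply: (@le_trans _ _ ((\sum_m `|(z l k - x) ord0 m|) * M3)).
      apply: (@partial_bound_increment R n _ _ _ M3 (6 * r) x).
      - exact: Ck1_derivable (c2 k l).
      - move=> i; rewrite subrr normr0 add0r !mxE.
        by apply: (le_trans (zB l k i)); lra.
      - by move=> y m hy; exact: (hM3 (m, k, l) y hy).
    by rewrite ler_wpM2r//; apply: sum_le_natmul => m; rewrite !mxE.
  have hlk l : `|q ord0 l * (\sum_k w ord0 k * partial k (partial l f) (z l k))
       - q ord0 l * (\sum_k w ord0 k * partial k (partial l f) x)| <= N * B.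
    rewrite -mulrBr -sumrB normrM.
    apply: (@le_trans _ _ (enorm q * (N * (enorm w * (N * (3 * (enorm w + enorm q)) * M3))))).
      rewrite ler_pM ?coord_le_enorm//; apply: (le_trans (ler_norm_sum _ _ _)).
      apply: sum_le_natmul => k.
      by rewrite -mulrBr normrM ler_pM ?coord_le_enorm.
    by rewrite le_eqVlt; apply/orP; left; apply/eqP; rewrite /B; ring.
  apply: (@le_trans _ _ (4 * (N * (N * B)))).
    rewrite ler_wpM2l//; apply: (le_trans (ler_norm_sum _ _ _)).
    exact: sum_le_natmul.
  rewrite (_ : 4 * (N * (N * B)) =
    12 * N ^+ 3 * M3 * (enorm w * enorm q * (enorm w + enorm q))); last by rewrite /B; ring.
  by rewrite ler_wpM2r ?mulr_ge0 ?addr_ge0//; lra.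
Qed.

End second_difference.

(** * Moments of the kernel *)

Section kernel.
Variables (R : realType) (n : nat).
Hypothesis n_gt0 : (0 < n)%N.
Local Notation leb := (@lebesgue_rV R n).
Implicit Types (q w x z : 'rV[R]_n) (beta d : R).

Lemma kernE beta q j : kern beta q ord0 j = enorm q `^ (- beta) * q ord0 j.
Proof. by rewrite /kern mxE powRN. Qed.

Lemma kernN beta q j : kern beta (- q) ord0 j = - kern beta q ord0 j.
Proof. by rewrite !kernE enormN mxE mulrN. Qed.

Lemma measurable_enorm_powR (p : R) : measurable_fun setT (fun q => enorm q `^ p).
Proof.
by apply: (measurableT_comp (measurable_powR _)); exact: measurable_enorm.
Qed.

Lemma measurable_kern beta j : measurable_fun setT (fun q => kern beta q ord0 j).
Proof.
rewrite (_ : (fun _ => _) = fun q => enorm q `^ (- beta) * q ord0 j); last first.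
  by apply/funext => q; rewrite kernE.
by apply: measurable_funM; [exact: measurable_enorm_powR|exact: measurable_coord].
Qed.

(** Equality holds for t > 0. At t = 0 the inequality absorbs the value of 0
    to the power 0. *)
Lemma powR_mul_le (t p : R) : 0 <= t -> t `^ p * t <= t `^ (p + 1).
Proof.
rewrite le_eqVlt => /predU1P[<-|t0]; first by rewrite mulr0 powR_ge0.
by rewrite powRD ?powRr1 ?(ltW t0)// (gt_eqF t0) implybT.
Qed.

Lemma kern_le beta q j : `|kern beta q ord0 j| <= enorm q `^ (1 - beta).
Proof.
rewrite kernE normrM [`|_ `^ _|]ger0_norm ?powR_ge0// addrC.
apply: le_trans (powR_mul_le _ (enorm_ge0 q)).
by rewrite ler_wpM2l ?powR_ge0// coord_le_enorm.
Qed.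

Lemma kern_enorm_le beta q j : `|kern beta q ord0 j| * enorm q <= enorm q `^ (2 - beta).
Proof.
have -> : 2 - beta = 1 - beta + 1 by ring.
apply: le_trans (powR_mul_le _ (enorm_ge0 q)).
by rewrite ler_wpM2r ?enorm_ge0// kern_le.
Qed.

Lemma kern_enorm2_le beta q j :
  `|kern beta q ord0 j| * enorm q ^+ 2 <= enorm q `^ (3 - beta).
Proof.
have -> : 3 - beta = 2 - beta + 1 by ring.
apply: le_trans (powR_mul_le _ (enorm_ge0 q)).
by rewrite expr2 mulrA ler_wpM2r ?enorm_ge0// kern_enorm_le.
Qed.

Definition moment2 beta d : R := \int[leb]_(q in eball d) enorm q `^ (2 - beta).
Definition moment3 beta d : R := \int[leb]_(q in eball d) enorm q `^ (3 - beta).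
(** The integral of K_j(q) q_j over the ball of radius d, for any j. *)
Definition coord_moment2 beta d : R :=
  ball_vol R n / (n%:R + 2 - beta) * d `^ (n%:R + 2 - beta).

Lemma moment2_ge0 beta d : 0 <= moment2 beta d.
Proof. by apply: Rintegral_ge0 => q _; exact: powR_ge0. Qed.

Lemma moment3_ge0 beta d : 0 <= moment3 beta d.
Proof. by apply: Rintegral_ge0 => q _; exact: powR_ge0. Qed.

Section fixed_parameters.
Variables (beta d : R).
Hypotheses (hb : beta < n%:R + 2) (d0 : 0 < d).
Local Notation m := (coord_moment2 beta d).

Let mB : measurable (@eball R n d). Proof. exact: measurable_eball. Qed.

Lemma integrable_pow2 K : leb.-integrable (eball d) (EFin \o (fun q => K * enorm q `^ (2 - beta))).
Proof.
have p0 : 0 < n%:R + (2 - beta) by move: hb; lra.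
have [ir _] := radial_moment n_gt0 p0 d0.
exact: (@integrableZl _ _ _ leb _ mB K _ ir).
Qed.

Lemma integrable_pow3 K : leb.-integrable (eball d) (EFin \o (fun q => K * enorm q `^ (3 - beta))).
Proof.
have p0 : 0 < n%:R + (3 - beta) by move: hb; lra.
have [ir _] := radial_moment n_gt0 p0 d0.
exact: (@integrableZl _ _ _ leb _ mB K _ ir).
Qed.

Lemma moment2E K : \int[leb]_(q in eball d) (K * enorm q `^ (2 - beta)) = K * moment2 beta d.
Proof.
have p0 : 0 < n%:R + (2 - beta) by move: hb; lra.
have [ir _] := radial_moment n_gt0 p0 d0.
exact: (RintegralZl K mB ir).
Qed.

Lemma moment3E K : \int[leb]_(q in eball d) (K * enorm q `^ (3 - beta)) = K * moment3 beta d.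
Proof.
have p0 : 0 < n%:R + (3 - beta) by move: hb; lra.
have [ir _] := radial_moment n_gt0 p0 d0.
exact: (RintegralZl K mB ir).
Qed.

Lemma measurable_kern_coord j l :
  measurable_fun setT (fun q => kern beta q ord0 j * q ord0 l).
Proof. by apply: measurable_funM; [exact: measurable_kern|exact: measurable_coord]. Qed.

Lemma integrable_kern_coord j l :
  leb.-integrable (eball d) (EFin \o (fun q => kern beta q ord0 j * q ord0 l)).
Proof.
apply: (dominated_integrable mB (measurable_kern_coord j l) _ (integrable_pow2 1)).
move=> q _; rewrite mul1r normrM; apply: le_trans (kern_enorm_le _ _ j).
by rewrite ler_wpM2l// coord_le_enorm.
Qed.

Lemma Rintegral_kern_coord j l :
  \int[leb]_(q in eball d) (kern beta q ord0 j * q ord0 l) = if j == l then m else 0.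
Proof.
have E (q : 'rV[R]_n) : kern beta q ord0 j * q ord0 l =
    q ord0 j * q ord0 l * enorm q `^ (- beta) by rewrite kernE; ring.
have itg := integrable_kern_coord j l.
have [jl|jl] := eqVneq j l.
  rewrite /coord_moment2; have [_ <-] := coord_moment n_gt0 l hb d0.
  by apply: eq_Rintegral => q _; rewrite E jl expr2.
under eq_Rintegral do rewrite E.
apply: Rintegral_odd_coord => //.
by apply: eq_integrable itg => // q _ /=; rewrite E.
Qed.

Lemma integrable_kern_linear j (a : 'I_n -> R) :
  leb.-integrable (eball d) (EFin \o (fun q => kern beta q ord0 j * \sum_l q ord0 l * a l)).
Proof.
rewrite (_ : EFin \o _ = (fun q => \sum_l (a l)%:E *
    (EFin \o (fun q => kern beta q ord0 j * q ord0 l)%R) q)%E).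
  apply: integrable_sum; first exact: mB.
  move=> l _.
  exact: (@integrableZl _ _ _ leb _ mB (a l) _ (integrable_kern_coord j l)).
apply/funext => q /=; rewrite mulr_sumr -sumEFin; apply: eq_bigr => l _.
by rewrite -EFinM; congr _%:E; ring.
Qed.

Lemma Rintegral_kern_linear j (a : 'I_n -> R) :
  \int[leb]_(q in eball d) (kern beta q ord0 j * \sum_l q ord0 l * a l) = m * a j.
Proof.
have E q : kern beta q ord0 j * (\sum_l q ord0 l * a l) =
    \sum_l a l * (kern beta q ord0 j * q ord0 l).
  by rewrite mulr_sumr; apply: eq_bigr => l _; ring.
under eq_Rintegral do rewrite E.
rewrite Rintegral_sumr//; last first.
  by move=> l; exact: (@integrableZl _ _ _ leb _ mB (a l) _ (integrable_kern_coord j l)).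
rewrite (bigD1 j)//= big1 ?addr0; last first.
  move=> l lj; rewrite (RintegralZl _ mB (integrable_kern_coord j l)).
  by rewrite Rintegral_kern_coord eq_sym (negbTE lj) mulr0.
rewrite (RintegralZl _ mB (integrable_kern_coord j j)) Rintegral_kern_coord eqxx.
exact: mulrC.
Qed.

End fixed_parameters.
End kernel.

(** * The inner integral *)

(** The integrals of the positive and negative parts are measurable in the
    parameter by Tonelli's theorem. *)
Lemma measurable_Rintegral_param d1 d2 (T1 : measurableType d1)
    (T2 : measurableType d2) (R : realType)
    (m2 : {sigma_finite_measure set T2 -> \bar R}) (D : set T2)
    (G : T1 * T2 -> R) :
  measurable D -> measurable_fun setT G ->
  measurable_fun setT (fun w => \int[m2]_(q in D) G (w, q)).
Proof.
move=> mD mG.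
have mE : measurable_fun setT (EFin \o G) by exact/measurable_EFinP.
have part (g : T1 * T2 -> \bar R) : measurable_fun setT g -> (forall p, (0 <= g p)%E) ->
    measurable_fun setT (fun w => (\int[m2]_(q in D) g (w, q))%E).
  move=> mg g0.
  have mTD : measurable ([set: T1] `*` D) by exact: measurableX.
  have mgD : measurable_fun setT (g \_ ([set: T1] `*` D)).
    by apply/(measurable_restrictT _ mTD); exact: measurable_funTS.
  have := measurable_fun_fubini_tonelli_F (m2 := m2) _ mgD.
  rewrite (_ : fubini_F _ _ = (fun w => (\int[m2]_(q in D) g (w, q))%E)).
    by apply => p; rewrite patchE; case: ifP.
  apply/funext => w; rewrite /fubini_F [RHS]integral_mkcond.
  apply: eq_integral => q _; rewrite !patchE.
  have -> : ((w, q) \in [set: T1] `*` D) = (q \in D).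
    by apply/idP/idP; rewrite !inE; [case|split].
  by [].
apply: (measurableT_comp (f := fine)) => //.
rewrite (_ : (fun w => _) = (fun w => \int[m2]_(q in D) (EFin \o G)^\+ (w, q)
    - \int[m2]_(q in D) (EFin \o G)^\- (w, q))%E); last first.
  apply/funext => w; rewrite integralE.
  by congr (_ - _)%E; apply: eq_integral => q _; rewrite ?funeposE ?funenegE.
apply: emeasurable_funB; apply: part => //.
- exact: measurable_funepos.
- exact: measurable_funeneg.
Qed.

Section inner_integral.
Variables (R : realType) (n : nat).
Hypothesis n_gt0 : (0 < n)%N.
Local Notation leb := (@lebesgue_rV R n).
Variables (u : 'rV[R]_n -> 'rV[R]_n) (x : 'rV[R]_n).
Hypothesis hu : Ck_field 3 u.
Implicit Types (q w : 'rV[R]_n).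
Local Notation u_ j := (fun y : 'rV[R]_n => u y ord0 j).

Definition inner_integrand (beta : R) w q : R := edot (kern beta q) (u (x + w + q)).

Definition inner_integral (beta d : R) w : R :=
  \int[leb]_(q in eball d) even_part (inner_integrand beta w) q.

Lemma even_inner_integrandE beta w q :
  even_part (inner_integrand beta w) q =
  \sum_j kern beta q ord0 j * ((u (x + w + q) ord0 j - u (x + w - q) ord0 j) / 2).
Proof.
rewrite /even_part /inner_integrand /edot -big_split/= mulr_suml.
by apply: eq_bigr => j _; rewrite kernN; ring.
Qed.

Let measurable_u j : measurable_fun setT (u_ j).
Proof. by apply: continuous_measurable_rV; exact: Ck_continuous (hu j). Qed.

Lemma measurable_translate :
  measurable_fun setT (fun p : 'rV[R]_n * 'rV[R]_n => x + p.1 + p.2).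
Proof.
apply: measurable_fun_rVP => i.
rewrite (_ : _ \o _ = fun p : 'rV[R]_n * 'rV[R]_n =>
    x ord0 i + p.1 ord0 i + p.2 ord0 i); last first.
  by apply/funext => p; rewrite /= /rV_coord !mxE.
apply: measurable_funD; first apply: measurable_funD => //.
- by apply: (measurableT_comp (@measurable_coord R n i)).
- by apply: (measurableT_comp (@measurable_coord R n i)).
Qed.

Lemma measurable_inner_integrand2 beta :
  measurable_fun setT (fun p : 'rV[R]_n * 'rV[R]_n => inner_integrand beta p.1 p.2).
Proof.
apply: measurable_sum => j; apply: measurable_funM.
  by apply: (measurableT_comp (measurable_kern beta j)).
by apply: (measurableT_comp (measurable_u j)); exact: measurable_translate.
Qed.

Lemma measurable_inner_integrand beta w : measurable_fun setT (inner_integrand beta w).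
Proof.
exact: (measurableT_comp (measurable_inner_integrand2 beta) (pair1_measurable w)).
Qed.

Lemma measurable_inner_integral beta d : measurable_fun setT (inner_integral beta d).
Proof.
apply: (@measurable_Rintegral_param _ _ _ _ R leb (eball d)
  (fun p => even_part (inner_integrand beta p.1) p.2)).
  exact: measurable_eball.
apply: measurable_funM => //; apply: measurable_funD.
  exact: measurable_inner_integrand2.
apply: (measurableT_comp (measurable_inner_integrand2 beta)
  (g := fun p : 'rV[R]_n * 'rV[R]_n => (p.1, - p.2))).
apply/measurable_fun_pairP; split; first exact: measurable_fst.
exact: (measurableT_comp (@measurable_opp_rV R n) measurable_snd).
Qed.

Lemma C3_field_bounds (r : R) : 0 < r ->
  exists2 C : R, 0 <= C & forall j w q, enorm w < r -> enorm q < r ->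
    [/\ `|u (x + w + q) ord0 j| <= C,
        `|u (x + w + q) ord0 j - u (x + w - q) ord0 j| <= C * enorm q &
        `|second_diff (u_ j) x w q - 4 * hess_form (u_ j) x w q|
          <= C * (enorm w * enorm q * (enorm w + enorm q))].
Proof.
move=> r0.
have H j : exists C : R, 0 <= C /\ forall w q, enorm w < r -> enorm q < r ->
    [/\ `|u (x + w + q) ord0 j| <= C,
        `|u (x + w + q) ord0 j - u (x + w - q) ord0 j| <= C * enorm q &
        `|second_diff (u_ j) x w q - 4 * hess_form (u_ j) x w q|
          <= C * (enorm w * enorm q * (enorm w + enorm q))].
  by have [C ? ?] := C3_bounds x (hu j) r0; exists C.
have [C HC] := choice H.
have C0 j : 0 <= C j by have [] := HC j.
exists (\sum_j C j); first exact: sumr_ge0.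
move=> j w q wr qr; have [_ /(_ w q wr qr)[b0 b1 b2]] := HC j.
have Cj : C j <= \sum_j C j by rewrite (bigD1 j)//= lerDl sumr_ge0.
split.
- exact: le_trans b0 Cj.
- by apply: (le_trans b1); rewrite ler_wpM2r// enorm_ge0.
- by apply: (le_trans b2); rewrite ler_wpM2r// !mulr_ge0 ?addr_ge0 ?enorm_ge0.
Qed.

Section fixed_parameters.
Variables (beta d C : R).
Hypotheses (hb : beta < n%:R + 2) (d0 : 0 < d) (C0 : 0 <= C).
Local Notation D := (@eball R n d).

Let mB : measurable D. Proof. exact: measurable_eball. Qed.

Section fixed_w.
Variable w : 'rV[R]_n.
Hypothesis Cw : forall j q, enorm q < d ->
  `|u (x + w + q) ord0 j| <= C /\
  `|u (x + w + q) ord0 j - u (x + w - q) ord0 j| <= C * enorm q.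

Lemma inner_integrand_le q : D q ->
  `|inner_integrand beta w q| <= n%:R * C * enorm q `^ (1 - beta).
Proof.
move=> Dq; rewrite -mulrA; apply: (le_trans (ler_norm_sum _ _ _)).
apply: sum_le_natmul => j; rewrite normrM mulrC.
by rewrite ler_pM ?kern_le//; have [] := Cw j Dq.
Qed.

Lemma even_inner_integrand_le q : D q ->
  `|even_part (inner_integrand beta w) q| <= n%:R * C * enorm q `^ (2 - beta).
Proof.
move=> Dq; rewrite even_inner_integrandE -mulrA.
apply: (le_trans (ler_norm_sum _ _ _)); apply: sum_le_natmul => j.
rewrite !normrM; have [_ h] := Cw j Dq.
apply: (@le_trans _ _ (C * (`|kern beta q ord0 j| * enorm q))).
  rewrite [leRHS]mulrCA ler_wpM2l// [`|2^-1|]ger0_norm//.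
  by have := normr_ge0 (u (x + w + q) ord0 j - u (x + w - q) ord0 j); lra.
by rewrite ler_wpM2l// kern_enorm_le.
Qed.

Lemma integrable_even_inner :
  leb.-integrable D (EFin \o even_part (inner_integrand beta w)).
Proof.
apply: (dominated_integrable mB _ even_inner_integrand_le).
  by apply: measurable_even_part; exact: measurable_inner_integrand.
exact: integrable_pow2.
Qed.

Lemma inner_integral_le : `|inner_integral beta d w| <= n%:R * C * moment2 n beta d.
Proof.
rewrite -(moment2E n_gt0 hb d0); apply: dominated_Rintegral => //.
- by apply: measurable_even_part; exact: measurable_inner_integrand.
- exact: even_inner_integrand_le.
- exact: integrable_pow2.
Qed.

(** The components of the integrand are those of the constant vector K(w)
    times a scalar function of q that has the sizes required by
    [ball_integral_even_part]. *)
Lemma inner_ball_integral :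
  ball_integral d beta (fun q => tens (kern beta w) (kern beta q) (u (x + w + q))) =
  inner_integral beta d w *: kern beta w.
Proof.
have E i q : tens (kern beta w) (kern beta q) (u (x + w + q)) ord0 i =
    inner_integrand beta w q * kern beta w ord0 i by rewrite /tens mxE.
pose K := \sum_i `|kern beta w ord0 i|.
have K0 : 0 <= K by exact: sumr_ge0.
have Ki i : `|kern beta w ord0 i| <= K by rewrite /K (bigD1 i)//= lerDl sumr_ge0.
rewrite (@ball_integral_even_part R n n_gt0 beta d (n%:R * C * K) (2 * (n%:R * C * K)))//.
- apply/rowP => i; rewrite mxE [RHS]mxE /inner_integral.
  rewrite -(RintegralZr _ mB integrable_even_inner).
  apply: eq_Rintegral => q _; by rewrite /even_part !E; ring.
- move=> i; rewrite (_ : (fun _ => _) = fun q => inner_integrand beta w q * kern beta w ord0 i).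
    by apply: measurable_funM => //; exact: measurable_inner_integrand.
  by apply/funext => q; rewrite E.
- move=> i q Dq; rewrite E normrM mulrAC.
  by rewrite ler_pM// inner_integrand_le.
- move=> i q Dq; rewrite !E -mulrDl normrM.
  have -> : 2 * (n%:R * C * K) * enorm q `^ (2 - beta) =
    (2 * (n%:R * C * enorm q `^ (2 - beta))) * K by ring.
  rewrite ler_pM//; have := even_inner_integrand_le Dq.
  by rewrite /even_part normrM [`|2^-1|]ger0_norm//; lra.
Qed.

End fixed_w.

End fixed_parameters.
End inner_integral.

(** * The outer integral *)

Section outer_integral.
Variables (R : realType) (n : nat).
Hypothesis n_gt0 : (0 < n)%N.
Local Notation leb := (@lebesgue_rV R n).
Variables (u : 'rV[R]_n -> 'rV[R]_n) (x : 'rV[R]_n).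
Hypothesis hu : Ck_field 3 u.
Implicit Types (q w : 'rV[R]_n).
Local Notation u_ j := (fun y : 'rV[R]_n => u y ord0 j).

Definition grad_div (k : 'I_n) : R := \sum_j partial k (partial j (u_ j)) x.

Lemma grad_divergenceE k : grad (divergence u) x ord0 k = grad_div k.
Proof.
rewrite mxE /partial /divergence.
rewrite (_ : (fun y => \sum_i partial i (u_ i) y) = \sum_i partial i (u_ i)).
  rewrite derive_sum// => j.
  exact: (Ck1_derivable (Ck_partial j (hu j))).
by apply/funext => y; rewrite fct_sumE.
Qed.

Variables (beta d r C : R).
Hypotheses (hb : beta < n%:R + 2) (d0 : 0 < d) (dr : d <= r) (C0 : 0 <= C).
Hypothesis hC : forall j w q, enorm w < r -> enorm q < r ->
    [/\ `|u (x + w + q) ord0 j| <= C,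
        `|u (x + w + q) ord0 j - u (x + w - q) ord0 j| <= C * enorm q &
        `|second_diff (u_ j) x w q - 4 * hess_form (u_ j) x w q|
          <= C * (enorm w * enorm q * (enorm w + enorm q))].
Local Notation D := (@eball R n d).
Local Notation m := (@coord_moment2 R n beta d).
Local Notation m2 := (@moment2 R n beta d).
Local Notation m3 := (@moment3 R n beta d).
Local Notation S := (inner_integral u x beta d).

Let mB : measurable D. Proof. exact: measurable_eball. Qed.

Let bound_w w : D w -> forall j q, enorm q < d ->
  `|u (x + w + q) ord0 j| <= C /\
  `|u (x + w + q) ord0 j - u (x + w - q) ord0 j| <= C * enorm q.
Proof.
move=> Dw j q qd.
by have [] := hC j (lt_le_trans Dw dr) (lt_le_trans qd dr).
Qed.

Let D_opp w : D w -> D (- w).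
Proof. by rewrite /eball/= enormN. Qed.

(** The second derivatives of u_j give the linear form
    q -> 2 sum_l q_l sum_k w_k d_k d_l u_j, of which K_j retains only the l = j
    term; the remainder of [C3_bounds] is integrated against |K_j|. *)
Lemma inner_increment w : D w ->
  `|S w - S (- w) - 2 * (m * \sum_k w ord0 k * grad_div k)|
    <= n%:R * C / 2 * enorm w * (enorm w * m2 + m3).
Proof.
move=> Dw; have w0 := enorm_ge0 w.
have i1 := integrable_even_inner n_gt0 hu hb d0 C0 (bound_w Dw).
have i2 := integrable_even_inner n_gt0 hu hb d0 C0 (bound_w (D_opp Dw)).
(* lin is the part of the integrand that comes from the second derivatives *)
pose a j l := 2 * \sum_k w ord0 k * partial k (partial l (u_ j)) x.
pose lin q := \sum_j kern beta q ord0 j * \sum_l q ord0 l * a j l.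
have ilin j := integrable_kern_linear n_gt0 hb d0 j (a j).
have i_lin : leb.-integrable D (EFin \o lin).
  rewrite (_ : EFin \o lin = fun q => (\sum_j (EFin \o
      (fun q => kern beta q ord0 j * \sum_l q ord0 l * a j l)%R) q)%E).
    by apply: integrable_sum => [|j _]; [exact: mB|exact: ilin].
  by apply/funext => q /=; rewrite sumEFin.
have -> : 2 * (m * \sum_k w ord0 k * grad_div k) = \int[leb]_(q in D) lin q.
  rewrite /lin (Rintegral_sumr mB ilin).
  transitivity (\sum_j m * a j j); last first.
    by apply: eq_bigr => j _; rewrite (Rintegral_kern_linear n_gt0 hb d0 j (a j)).
  rewrite -mulr_sumr mulrCA; congr (_ * _); rewrite -mulr_sumr; congr (_ * _).
  rewrite exchange_big/=; apply: eq_bigr => k _.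
  by rewrite mulr_sumr.
have i12 : leb.-integrable D (EFin \o (fun q => even_part (inner_integrand u x beta w) q -
    even_part (inner_integrand u x beta (- w)) q)).
  exact: (integrableB mB i1 i2).
rewrite /inner_integral -RintegralB// -RintegralB//.
pose A := n%:R * C / 2 * enorm w * enorm w; pose B := n%:R * C / 2 * enorm w.
have -> : n%:R * C / 2 * enorm w * (enorm w * m2 + m3) =
   \int[leb]_(q in D) (A * enorm q `^ (2 - beta) + B * enorm q `^ (3 - beta)).
  rewrite (RintegralD mB (integrable_pow2 n_gt0 hb d0 A) (integrable_pow3 n_gt0 hb d0 B)).
  by rewrite (moment2E n_gt0 hb d0) (moment3E n_gt0 hb d0) /A /B; ring.
apply: dominated_Rintegral => //.
- apply: measurable_funB; first apply: measurable_funB.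
  + by apply: measurable_even_part; exact: measurable_inner_integrand.
  + by apply: measurable_even_part; exact: measurable_inner_integrand.
  + apply: measurable_sum => j; apply: measurable_funM; first exact: measurable_kern.
    by apply: measurable_sum => l; apply: measurable_funM => //; exact: measurable_coord.
- move=> q Dq; have q0 := enorm_ge0 q.
  rewrite !even_inner_integrandE /lin -!sumrB.
  have wr := lt_le_trans Dw dr; have qr := lt_le_trans Dq dr.
  have E j : kern beta q ord0 j * ((u (x + w + q) ord0 j - u (x + w - q) ord0 j) / 2)
     - kern beta q ord0 j * ((u (x - w + q) ord0 j - u (x - w - q) ord0 j) / 2)
     - kern beta q ord0 j * (\sum_l q ord0 l * a j l) =
     kern beta q ord0 j * ((second_diff (u_ j) x w q - 4 * hess_form (u_ j) x w q) / 2).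
    have -> : \sum_l q ord0 l * a j l = 2 * hess_form (u_ j) x w q.
      by rewrite /hess_form mulr_sumr; apply: eq_bigr => l _; rewrite /a; ring.
    by rewrite /second_diff; field.
  under eq_bigr do rewrite E.
  apply: (@le_trans _ _ (n%:R * (C / 2 * enorm w *
      (enorm w * enorm q `^ (2 - beta) + enorm q `^ (3 - beta))))); last first.
    by rewrite le_eqVlt; apply/orP; left; apply/eqP; rewrite /A /B; ring.
  apply: (le_trans (ler_norm_sum _ _ _)); apply: sum_le_natmul => j.
  have [_ _ h] := hC j wr qr.
  rewrite !normrM [`|2^-1|]ger0_norm//.
  apply: (@le_trans _ _ (`|kern beta q ord0 j| *
      (C * (enorm w * enorm q * (enorm w + enorm q)) / 2))).
    by rewrite ler_wpM2l// ler_wpM2r.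
  rewrite (_ : `|kern beta q ord0 j| * (C * (enorm w * enorm q * (enorm w + enorm q)) / 2) =
    C / 2 * enorm w * (enorm w * (`|kern beta q ord0 j| * enorm q) +
    `|kern beta q ord0 j| * enorm q ^+ 2)); last by ring.
  rewrite ler_wpM2l ?mulr_ge0// lerD ?kern_enorm2_le//.
  by rewrite ler_wpM2l// kern_enorm_le.
- exact: (integrableD mB (integrable_pow2 n_gt0 hb d0 A) (integrable_pow3 n_gt0 hb d0 B)).
Qed.

Definition outer_integrand (i : 'I_n) w : R := S w * kern beta w ord0 i.
Local Notation outer := outer_integrand.

Let even_outerE i w : even_part (outer i) w =
  (S w - S (- w) - 2 * (m * \sum_k w ord0 k * grad_div k)) / 2 * kern beta w ord0 i
  + kern beta w ord0 i * \sum_k w ord0 k * (m * grad_div k).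
Proof.
rewrite /even_part /outer_integrand kernN.
have -> : \sum_k w ord0 k * (m * grad_div k) = m * \sum_k w ord0 k * grad_div k.
  by rewrite mulr_sumr; apply: eq_bigr => k _; ring.
by field.
Qed.

Lemma outer_estimate i :
  `|\int[leb]_(w in D) even_part (outer i) w - m ^+ 2 * grad_div i|
    <= n%:R * C / 2 * (m2 * m3).
Proof.
pose err w := (S w - S (- w) - 2 * (m * \sum_k w ord0 k * grad_div k)) / 2 * kern beta w ord0 i.
pose A := n%:R * C / 4 * m2; pose B := n%:R * C / 4 * m3.
have mS := measurable_inner_integral x hu beta d.
have merr : measurable_fun setT err.
  apply: measurable_funM; last exact: measurable_kern.
  apply: measurable_funM; last exact: measurable_cst.
  apply: measurable_funB.
    apply: measurable_funB; first exact: mS.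
    by apply: (measurableT_comp mS); exact: measurable_opp_rV.
  apply: measurable_funM; first exact: measurable_cst.
  apply: measurable_funM; first exact: measurable_cst.
  by apply: measurable_sum => l; apply: measurable_funM => //; exact: measurable_coord.
have ib : leb.-integrable D (EFin \o (fun w =>
    B * enorm w `^ (2 - beta) + A * enorm w `^ (3 - beta))).
  exact: (integrableD mB (integrable_pow2 n_gt0 hb d0 B) (integrable_pow3 n_gt0 hb d0 A)).
have errB w : D w -> `|err w| <= B * enorm w `^ (2 - beta) + A * enorm w `^ (3 - beta).
  move=> Dw; have h := inner_increment Dw; have w0 := enorm_ge0 w.
  have m20 := @moment2_ge0 R n beta d; have m30 := @moment3_ge0 R n beta d.
  rewrite /err !normrM [`|2^-1|]ger0_norm//.
  apply: (@le_trans _ _ (n%:R * C / 2 * enorm w * (enorm w * m2 + m3) / 2 * `|kern beta w ord0 i|)).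
    by rewrite ler_wpM2r// ler_wpM2r.
  rewrite (_ : n%:R * C / 2 * enorm w * (enorm w * m2 + m3) / 2 * `|kern beta w ord0 i| =
     B * (`|kern beta w ord0 i| * enorm w) +
     A * (`|kern beta w ord0 i| * enorm w ^+ 2)); last by rewrite /A /B; field.
  by rewrite lerD// ler_wpM2l ?kern_enorm_le ?kern_enorm2_le ?mulr_ge0.
have ierr := dominated_integrable mB merr errB ib.
have ilin := integrable_kern_linear n_gt0 hb d0 i (fun k => m * grad_div k).
under eq_Rintegral do rewrite even_outerE.
rewrite (RintegralD mB ierr ilin) Rintegral_kern_linear// mulrA -expr2 addrK.
apply: (le_trans (dominated_Rintegral mB merr errB ib)).
rewrite (RintegralD mB (integrable_pow2 n_gt0 hb d0 B) (integrable_pow3 n_gt0 hb d0 A)).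
rewrite (moment2E n_gt0 hb d0) (moment3E n_gt0 hb d0) le_eqVlt; apply/orP; left; apply/eqP.
by rewrite /A /B; field.
Qed.

Lemma outer_ball_integral :
  ball_integral d beta (fun w =>
    ball_integral d beta (fun q => tens (kern beta w) (kern beta q) (u (x + w + q)))) =
  \row_i \int[leb]_(w in D) even_part (outer i) w.
Proof.
have -> : (fun w => ball_integral d beta
    (fun q => tens (kern beta w) (kern beta q) (u (x + w + q)))) =
    (fun w => S w *: kern beta w).
  apply/funext => w; have w0 := enorm_ge0 w.
  have rw0 : 0 < enorm w + d + 1 by move: d0; lra.
  (* w is any vector here, so u is bounded on a ball that contains it *)
  have [C' C'0 hC'] := C3_field_bounds x hu rw0.
  apply: (inner_ball_integral n_gt0 hu hb d0 C'0) => j q qd.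
  have hw : enorm w < enorm w + d + 1 by move: d0; lra.
  have hq : enorm q < enorm w + d + 1 by lra.
  by have [] := hC' j w q hw hq.
have mS := measurable_inner_integral x hu beta d.
have m20 := @moment2_ge0 R n beta d; have m30 := @moment3_ge0 R n beta d.
have m0 : 0 <= m.
  rewrite /coord_moment2 mulr_ge0 ?powR_ge0// divr_ge0 ?ltW ?ball_vol_gt0//.
  by move: hb; lra.
pose G := \sum_k `|grad_div k|.
have E i : (fun w => (S w *: kern beta w) ord0 i) = outer i.
  by apply/funext => w; rewrite mxE.
pose K := 2 * (m * G) + n%:R * C / 2 * (d * m2 + m3).
have G0 : 0 <= G by exact: sumr_ge0.
have K0 : 0 <= K.
  apply: addr_ge0; first by exact: (mulr_ge0 (ler0n R 2) (mulr_ge0 m0 G0)).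
  apply: mulr_ge0; first by rewrite divr_ge0// mulr_ge0// ler0n.
  by exact: (addr_ge0 (mulr_ge0 (ltW d0) m20) m30).
rewrite (@ball_integral_even_part R n n_gt0 beta d (n%:R * C * m2) K)//.
- by apply/rowP => i; rewrite mxE [RHS]mxE E.
- by move=> i; rewrite E; apply: measurable_funM => //; exact: measurable_kern.
- move=> i w Dw; rewrite mxE normrM.
  rewrite ler_pM ?kern_le//.
  exact: (inner_integral_le n_gt0 hu hb d0 C0 (bound_w Dw)).
- move=> i w Dw; rewrite mxE [X in _ + X]mxE kernN mulrN -mulrBl normrM.
  have w0 := enorm_ge0 w.
  apply: (@le_trans _ _ (K * enorm w * `|kern beta w ord0 i|)); last first.
    by rewrite -mulrA [enorm w * _]mulrC ler_wpM2l ?kern_enorm_le.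
  rewrite ler_wpM2r//.
  have h := inner_increment Dw.
  have hG : `|\sum_k w ord0 k * grad_div k| <= enorm w * G.
    apply: (le_trans (ler_norm_sum _ _ _)); rewrite mulr_sumr; apply: ler_sum => k _.
    by rewrite normrM ler_wpM2r// coord_le_enorm.
  rewrite -[X in `|X|](subrK (2 * (m * \sum_k w ord0 k * grad_div k))).
  apply: (le_trans (ler_normD _ _)); rewrite /K [leRHS]mulrDl [leLHS]addrC lerD//.
    rewrite normrM [`|2|]ger0_norm// [`|m * _|]normrM (ger0_norm m0).
    have -> : 2 * (m * G) * enorm w = 2 * (m * (enorm w * G)) by ring.
    by apply: ler_wpM2l => //; apply: ler_wpM2l.
  apply: (le_trans h); rewrite mulrAC ler_wpM2r// ler_wpM2l//.
    by rewrite divr_ge0// mulr_ge0// ler0n.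
  by rewrite lerD2r ler_wpM2r// ltW.
Qed.

End outer_integral.

(** * The two limits *)

(** By [ball_vol_Gamma], the Gamma factor of c is pi^(n / 2) divided by the
    volume of the unit ball. *)
Lemma peri_c_coord_moment2 (R : realType) (n : nat) (beta d : R) :
  (0 < n)%N -> beta < n%:R + 2 -> 0 < d ->
  peri_c n d beta * coord_moment2 n beta d = 2.
Proof.
move=> n0 hb d0; rewrite /peri_c /coord_moment2 -(ball_vol_Gamma R n0).
have nb : 0 < n%:R + 2 - beta by rewrite subr_gt0.
have V0 := ball_vol_gt0 R n0.
have G0 : Gamma (n%:R / 2 + 1) != 0 :> R.
  apply/eqP => G0; have := powR_gt0 (n%:R / 2) (pi_gt0 R).
  by rewrite -(ball_vol_Gamma R n0) G0 mulr0 ltxx.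
have P0 := powR_gt0 (n%:R + 2 - beta) d0.
by field; rewrite G0 (gt_eqF nb) (gt_eqF V0) (gt_eqF P0).
Qed.

(** Since c = 2 / m, the bound of [outer_estimate] is multiplied by m^-2, and
    the ratio m2 m3 / m^2 is n^2 d (n + 2 - beta) / (n + 3 - beta). *)
Lemma Ls_estimate (R : realType) (n : nat) (mu lambda : R)
    (u : 'rV[R]_n -> 'rV[R]_n) (x : 'rV[R]_n) (r : R) :
  (0 < n)%N -> Ck_field 3 u -> 0 < r ->
  exists2 K : R, 0 <= K & forall beta d i, beta < n%:R + 2 -> 0 < d -> d <= r ->
    `|Ls mu lambda d beta u x ord0 i - ((lambda - mu) *: grad (divergence u) x) ord0 i|
      <= K * (d * ((n%:R + 2 - beta) / (n%:R + 3 - beta))).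
Proof.
move=> n0 hu r0; have [C C0 hC] := C3_field_bounds x hu r0.
pose N : R := n%:R.
have N_ge0 : 0 <= N by rewrite ler0n.
exists (`|lambda - mu| * (N ^+ 3 * C / 2)).
  by rewrite mulr_ge0// divr_ge0// mulr_ge0// exprn_ge0.
move=> beta d i hb d0 dr.
pose m := coord_moment2 n beta d; pose c := peri_c n d beta.
have cm : c * m = 2 := peri_c_coord_moment2 n0 hb d0.
have nb : 0 < N + 2 - beta by rewrite subr_gt0.
have nb3 : 0 < N + 3 - beta by lra.
have m_gt0 : 0 < m by rewrite mulr_gt0 ?powR_gt0// divr_gt0// ball_vol_gt0.
have cE : c ^+ 2 / 4 = (m ^+ 2)^-1.
  have -> : c = 2 / m by rewrite -cm mulfK// gt_eqF.
  by field; rewrite gt_eqF.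
rewrite /Ls (outer_ball_integral n0 hu hb d0 dr C0 hC) !mxE -/(divergence u).
have -> : partial i (divergence u) x = grad_div u x i by rewrite -grad_divergenceE// mxE.
have := outer_estimate n0 hu hb d0 dr C0 hC i.
rewrite -/m; set J := Rintegral _ _ _ => hJ.
rewrite -/c cE -mulrA -mulrBr normrM -[leRHS]mulrA ler_wpM2l//.
have -> : (m ^+ 2)^-1 * J - grad_div u x i = (m ^+ 2)^-1 * (J - m ^+ 2 * grad_div u x i).
  by field; rewrite gt_eqF.
have m2_gt0 : 0 < m ^+ 2 by rewrite exprn_gt0.
rewrite normrM gtr0_norm ?invr_gt0// mulrC ler_pdivrMr//.
apply: (le_trans hJ).
have p2 : 0 < n%:R + (2 - beta) by rewrite -/N; lra.
have p3 : 0 < n%:R + (3 - beta) by rewrite -/N; lra.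
have [_ E2] := radial_moment n0 p2 d0; have [_ E3] := radial_moment n0 p3 d0.
have F2 : moment2 n beta d = N * m.
  by rewrite /moment2 E2 /m /coord_moment2 -/N addrA !mulrA.
have F3 : moment3 n beta d = N * (d * ((N + 2 - beta) / (N + 3 - beta))) * m.
  rewrite /moment3 E3 /m /coord_moment2 -/N.
  have -> : N + (3 - beta) = 1 + (N + 2 - beta) by ring.
  rewrite powRD; last by rewrite (gt_eqF d0) implybT.
  rewrite powRr1 ?ltW//.
  have h1 : N + 2 - beta != 0 by rewrite gt_eqF.
  have h2 : N + 3 - beta != 0 by rewrite gt_eqF.
  have h3 : 1 + (N + 2 - beta) != 0 by rewrite gt_eqF//; lra.
  by field; rewrite ?h1 ?h2 ?h3.
rewrite F2 F3 le_eqVlt; apply/orP; left; apply/eqP.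
by rewrite -/N; field; rewrite gt_eqF.
Qed.

Theorem theorem11 (R : realType) (n : nat) (hn : (1 <= n)%N)
    (mu lambda : R) (u : 'rV[R]_n -> 'rV[R]_n) (hu : Ck_field 3 u)
    (x : 'rV[R]_n) :
  (forall beta : R, beta < n%:R + 2 ->
    Ls mu lambda delta beta u x @[delta --> 0^'+]
      --> (lambda - mu) *: grad (divergence u) x) /\
  (forall delta : R, 0 < delta ->
    Ls mu lambda delta beta u x @[beta --> (n%:R + 2)^'-]
      --> (lambda - mu) *: grad (divergence u) x).
Proof.
split=> [beta hb|delta d0].
  have [K K0 hK] := @Ls_estimate R n mu lambda u x 1 hn hu ltr01.
  apply: (@cvg_rV_bound _ _ _ _ _ _ _ (fun d => K * (d * ((n%:R + 2 - beta) / (n%:R + 3 - beta))))).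
    rewrite -[X in _ --> X](mulr0 K); apply: cvgM; first exact: cvg_cst.
    rewrite -[X in _ --> X](mul0r ((n%:R + 2 - beta) / (n%:R + 3 - beta))).
    apply: cvgM; last exact: cvg_cst.
    by apply: cvg_at_right_filter; exact: cvg_id.
  near=> d.
  have d0 : 0 < d by near: d; exact: nbhs_right_gt.
  have d1 : d <= 1 by near: d; exact: nbhs_right_le.
  by move=> i; exact: hK.
have [K K0 hK] := @Ls_estimate R n mu lambda u x delta hn hu d0.
apply: (@cvg_rV_bound _ _ _ _ _ _ _ (fun b => K * (delta * (n%:R + 2 - b)))).
  rewrite -[X in _ --> X](mulr0 K); apply: cvgM; first exact: cvg_cst.
  rewrite -[X in _ --> X](mulr0 delta); apply: cvgM; first exact: cvg_cst.
  rewrite -(subrr (n%:R + 2 : R)); apply: cvgB; first exact: cvg_cst.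
  by apply: cvg_at_left_filter; exact: cvg_id.
near=> b.
have hb : b < n%:R + 2 by near: b; exact: nbhs_left_lt.
move=> i.
apply: (le_trans (hK b delta i hb d0 (lexx _))).
rewrite ler_wpM2l// ler_wpM2l ?(ltW d0)// ler_pdivrMr; last by lra.
by rewrite ler_peMr; lra.
Unshelve. all: by end_near. Qed.
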